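(* Let $\mathcal{R}=\mathcal{R}_1\coprod\cdots\coprod\mathcal{R}_k$ be a family of rays in $\mathbb{R}^2$ whose germs are pairwise disjoint. Assume that for every $i\in\{1,\dots,k\}$ there is a countable subset $E_i\subset\mathcal{R}_i$ which is separating for $\mathcal{R}_i$. For every subset $I\subset\{1,\dots,k\}$ let $\mathbb{D}^2_I$ be the compactification of $\mathbb{R}^2$ associated to the rays in $\mathcal{R}_i$, $i\in I$, with circle at infinity $\mathbb{S}^1_I=\partial\mathbb{D}^2_I$. If $J\subset I$, then the identity map on $\mathbb{R}^2$ extends by continuity as a projection $\Pi_{I,J}:\mathbb{D}^2_I\to\mathbb{D}^2_J$. This projection consists in collapsing the intervals of $\mathbb{S}^1_I$ which do not contain any limit point of a ray in $\mathcal{R}_j$, $j\in J$. Furthermore, if $K\subset J$ then $$\Pi_{I,K}=\Pi_{J,K}\circ\Pi_{I,J}.$$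
   Context: A ray is a proper topological embedding of $[0,+\infty)$ in $\mathbb{R}^2$. Germs of two rays are disjoint if the rays have compact intersection. Rays with pairwise disjoint germs are totally cyclically ordered: for three of them choose disjoint representatives (up to removing compact initial parts) $\gamma_0,\gamma_1,\gamma_2$ and a simple closed curve $C$, oriented as boundary of the compact disc it bounds, meeting each $\gamma_i$ in exactly one point $p_i$; the cyclic order is that of $p_0,p_1,p_2$ on $C$. A subset $E$ of a totally cyclically ordered set $X$ is separating for $X$ if for any distinct $x,z\in X$ there is $y\in E$, distinct from $x,z$, between $x$ and $z$. A compactification of $\mathbb{R}^2$ by the closed disc $\mathbb{D}^2$ is a homeomorphism $\varphi:\mathbb{R}^2\to\mathring{\mathbb{D}}^2$ onto the open disc; two are identified if $\varphi_2\circ\varphi_1^{-1}$ extends to a homeomorphism of $\mathbb{D}^2$. $\mathbb{D}^2_I$ denotes the unique compactification such that: any ray of $\bigcup_{i\in I}\mathcal{R}_i$ tends to a point of $\mathbb{S}^1_I$; for every $i\in I$, distinct rays of $\mathcal{R}_i$ tend to distinct points of $\mathbb{S}^1_I$; and for any non-empty open interval $V\subset\mathbb{S}^1_I$ there is $i\in I$ such that at least $2$ rays in $\mathcal{R}_i$ have their limit point in $V$. *)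

(* Defs.v *)
From mathcomp Require Import all_boot all_order all_algebra.
From mathcomp Require Import all_classical all_reals all_analysis.
From Stdlib Require Import Relation_Operators.
Set Implicit Arguments.
Unset Strict Implicit.
Unset Printing Implicit Defensive.
Import Order.TTheory GRing.Theory Num.Theory numFieldNormedType.Exports.
Local Open Scope classical_set_scope.
Local Open Scope ring_scope.

Definition embedding_on (T U : topologicalType) (A : set T) (f : T -> U) : Prop :=
  {within A, continuous f} /\
  exists g : U -> T, {within f @` A, continuous g} /\ (forall x, A x -> g (f x) = x).

Section Plane.
Variable R : realType.

Definition plane := (R * R)%type.

Definition halfline : set R := [set t | 0 <= t].

Definition closed_disc : set plane := [set p | p.1 ^+ 2 + p.2 ^+ 2 <= 1].
Definition open_disc : set plane := [set p | p.1 ^+ 2 + p.2 ^+ 2 < 1].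
Definition circle : set plane := [set p | p.1 ^+ 2 + p.2 ^+ 2 = 1].

Definition cis (t : R) : plane := (cos t, sin t).

(* Counterclockwise open interval of the circle from [cis a] to [cis b]; it is
   a proper interval when [b - a <= 2 * pi] and the whole circle otherwise. *)
Definition open_arc (a b : R) : set plane := cis @` [set t | a < t < b].

(* Rays are functions on [R] of which only the restriction to the half-line
   matters.  Two functions that agree there never have disjoint germs, so a
   family with pairwise disjoint germs contains at most one of them. *)
Definition is_ray (r : R -> plane) : Prop :=
  embedding_on halfline r /\
  (forall K : set plane, compact K -> compact (halfline `&` r @^-1` K)).

Definition disjoint_germs (r s : R -> plane) : Prop :=
  compact ((r @` halfline) `&` (s @` halfline)).

Definition simple_closed_curve (c : R -> plane) : Prop :=
  [/\ {within [set t | 0 <= t <= 1], continuous c}, c 0 = c 1 &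
      forall s t, 0 <= s < 1 -> 0 <= t < 1 -> c s = c t -> s = t].

Definition curve_image (c : R -> plane) : set plane := c @` [set t | 0 <= t <= 1].

Definition inside (c : R -> plane) : set plane :=
  [set x | (~` curve_image c) x /\
           bounded_set (connected_component (~` curve_image c) x)].

(* [c] has winding number +1 about [x]: [rho] and [theta] are polar coordinates
   of [c] centred at [x], with [theta] a continuous determination of the angle. *)
Definition winds_once (c : R -> plane) (x : plane) : Prop :=
  exists theta rho : R -> R,
    [/\ {within [set t | 0 <= t <= 1], continuous theta},
        forall t, 0 <= t <= 1 ->
          0 < rho t /\
          c t = (x.1 + rho t * cos (theta t), x.2 + rho t * sin (theta t)) &
        theta 1 = theta 0 + 2 * pi].

(* Oriented as the boundary of the compact disc that it bounds. *)
Definition boundary_oriented (c : R -> plane) : Prop :=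
  forall x, inside c x -> winds_once c x.

Definition ray_tail (r : R -> plane) (t : R) : set plane := r @` [set u | t <= u].

(* [(r0, r1, r2)] is positively cyclically ordered.  The base point [c 0] is
   arbitrary, so it can be taken on the arc of the curve from [r2] to [r0]; this
   is why [s0 < s1 < s2] is asked rather than one of its cyclic permutations. *)
Definition ray_cyclic_order (r0 r1 r2 : R -> plane) : Prop :=
  exists t0 t1 t2 : R, exists c : R -> plane, exists s0 s1 s2 : R,
    [/\ [/\ 0 <= t0, 0 <= t1 & 0 <= t2],
        [/\ ray_tail r0 t0 `&` ray_tail r1 t1 = set0,
            ray_tail r1 t1 `&` ray_tail r2 t2 = set0 &
            ray_tail r0 t0 `&` ray_tail r2 t2 = set0],
        simple_closed_curve c /\ boundary_oriented c,
        [/\ curve_image c `&` ray_tail r0 t0 = [set c s0],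
            curve_image c `&` ray_tail r1 t1 = [set c s1] &
            curve_image c `&` ray_tail r2 t2 = [set c s2]] &
        [/\ 0 <= s0, s0 < s1, s1 < s2 & s2 < 1]].

Definition separating (E X : set (R -> plane)) : Prop :=
  E `<=` X /\
  forall x z, X x -> X z -> x <> z ->
    exists y, [/\ E y, y <> x, y <> z & ray_cyclic_order x y z].

Definition compactification (phi : plane -> plane) : Prop :=
  embedding_on setT phi /\ phi @` setT = open_disc.

Definition tends (phi : plane -> plane) (r : R -> plane) (p : plane) : Prop :=
  phi (r t) @[t --> +oo] --> p.

Section Family.
Variables (k : nat) (Rf : 'I_k -> set (R -> plane)).

(* [phi] represents the compactification [D^2_I] associated with the rays in
   [Rf i], [i \in I]. *)
Definition compactification_for (I : {set 'I_k}) (phi : plane -> plane) : Prop :=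
  [/\ compactification phi,
      forall i r, i \in I -> Rf i r -> exists p, circle p /\ tends phi r p,
      forall i r s p q, i \in I -> Rf i r -> Rf i s -> r <> s ->
        circle p -> circle q -> tends phi r p -> tends phi s q -> p <> q &
      forall a b : R, a < b -> exists i r s p q,
        [/\ i \in I, Rf i r /\ Rf i s, r <> s,
            tends phi r p /\ tends phi s q &
            open_arc a b p /\ open_arc a b q]].

Definition limit_points (J : {set 'I_k}) (phi : plane -> plane) : set plane :=
  [set p | circle p /\ exists j r, [/\ j \in J, Rf j r & tends phi r p]].

(* [p] and [q] are the endpoints of an interval of the circle at infinity of
   [phi] whose interior contains no limit point of a ray in [Rf j], [j \in J]. *)
Definition free_interval (J : {set 'I_k}) (phi : plane -> plane)
    (p q : plane) : Prop :=
  exists a b : R, [/\ a <= b, p = cis a, q = cis b &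
    open_arc a b `&` limit_points J phi = set0].

(* The equivalence relation on the circle obtained by collapsing these
   intervals.  It has to be generated: adjacent free intervals share an endpoint
   (possibly an isolated limit point) and so collapse to the same point. *)
Definition collapsed (J : {set 'I_k}) (phi : plane -> plane) :
    plane -> plane -> Prop :=
  clos_refl_sym_trans plane (free_interval J phi).

End Family.

(* [P], restricted to the closed disc, extends by continuity the identity of the
   plane, read in [phiI] at the source and in [phiJ] at the target. *)
Definition extends_identity (phiI phiJ P : plane -> plane) : Prop :=
  [/\ {within closed_disc, continuous P},
      forall p, closed_disc p -> closed_disc (P p) &
      forall x, P (phiI x) = phiJ x].

End Plane.

(* Main.v *)
(* Read in the two discs, the identity of the plane is a homeomorphism h between
   open discs.  If h had two cluster points at a point xi of the circle of [phiI],
   they would cut the circle of [phiJ] into two arcs.  Each arc receives two rays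
   of one family, which have distinct limits for [phiI], so one ray ending in it
   avoids xi.  Two such rays, joined by a segment, form a crosscut separating the
   two cluster points, whereas small half-discs at xi are connected, miss the
   crosscut and accumulate on both points.  This crossing argument is the only
   place where planar topology enters; it rests on a discrete Poincare-Miranda
   theorem.  The fibers of the extension P on the circle are connected because
   straight chords separate the disc, and each family has at most one limit point
   in an arc on which P is constant, so such an arc is a finite chain of free
   intervals. *)

Require Import Defs.
From mathcomp Require Import all_boot all_order all_algebra.
From mathcomp Require Import all_classical all_reals all_analysis.
From mathcomp Require Import ring lra.
Import Order.TTheory GRing.Theory Num.Theory numFieldNormedType.Exports.
Local Open Scope classical_set_scope.
Local Open Scope ring_scope.
Set Implicit Arguments.
Unset Strict Implicit.
Unset Printing Implicit Defensive.

(** * Chords, arcs and pencils of lines in the unit disc *)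

Section CircleGeometry.
Variable R : realType.
Implicit Types (p q u v z w : plane R) (a b t : R).

(** Twice the signed area of the triangle [p q z]: positive when [z] lies to the left of the line
    from [p] to [q]. *)
Definition side p q z : R :=
  (q.1 - p.1) * (z.2 - p.2) - (q.2 - p.2) * (z.1 - p.1).

Definition segpt p q t : plane R :=
  (p.1 + t * (q.1 - p.1), p.2 + t * (q.2 - p.2)).

Definition seg p q : set (plane R) := segpt p q @` `[0, 1].

Lemma circle_cis t : circle (cis t).
Proof. by rewrite /circle /cis /= cos2Dsin2. Qed.

Lemma cisD2pi t : cis (t + 2 * pi) = cis t.
Proof. by rewrite /cis mulr_natl cosD2pi sinD2pi. Qed.

Lemma side_cis a b t : side (cis a) (cis b) (cis t) =
  4 * (sin ((b - a) / 2) * sin ((t - a) / 2) * sin ((t - b) / 2)).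
Proof.
(* Halving the angles turns the goal into a polynomial identity modulo three Pythagorean
   relations. *)
have [x ax] : exists x, a = x + x by exists (a / 2); lra.
have [y by_] : exists x, b = x + x by exists (b / 2); lra.
have [z tz] : exists x, t = x + x by exists (t / 2); lra.
rewrite ax by_ tz.
have -> : (y + y - (x + x)) / 2 = y - x by lra.
have -> : (z + z - (x + x)) / 2 = z - x by lra.
have -> : (z + z - (y + y)) / 2 = z - y by lra.
rewrite /side /cis /= !sinB !cosD !sinD.
have := cos2Dsin2 x; have := cos2Dsin2 y; have := cos2Dsin2 z.
move: (cos x) (sin x) (cos y) (sin y) (cos z) (sin z) => cx sx cy sy cz sz Hz Hy Hx.
have -> : sx * sx = 1 - cx * cx by rewrite -Hx; ring.
have -> : sy * sy = 1 - cy * cy by rewrite -Hy; ring.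
have -> : sz * sz = 1 - cz * cz by rewrite -Hz; ring.
have Ex : sx ^+ 2 = 1 - cx ^+ 2 by rewrite -Hx; ring.
have Ey : sy ^+ 2 = 1 - cy ^+ 2 by rewrite -Hy; ring.
have Ez : sz ^+ 2 = 1 - cz ^+ 2 by rewrite -Hz; ring.
ring: Ex Ey Ez.
Qed.

(** For angles in this order the three half differences lie strictly between 0 and pi, so every sine
    is positive. *)
Lemma side_cis_gt0 a b t : a < b -> b < t -> t < a + 2 * pi ->
  0 < side (cis a) (cis b) (cis t).
Proof.
move=> ab bt ta; rewrite side_cis.
by do !(apply: mulr_gt0 => //); apply: sin_gt0_pi; apply/andP; split; lra.
Qed.

Lemma side_cis_lt0 a b t : a < t -> t < b -> b < a + 2 * pi ->
  side (cis a) (cis b) (cis t) < 0.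
Proof.
move=> at_ tb ba; have := @side_cis_gt0 a t b at_ tb ba.
by rewrite /side; lra.
Qed.

(** Otherwise the midpoint of the arc would lie strictly on one side of a chord with equal
    endpoints, for which [side] vanishes identically. *)
Lemma cis_inj a b : a <= b -> b < a + 2 * pi -> cis a = cis b -> a = b.
Proof.
rewrite le_eqVlt => /predU1P[//|ab] ba E.
have := @side_cis_lt0 a b ((a + b) / 2).
by rewrite E /side; lra.
Qed.

Lemma circle_cis_ge0 p : circle p -> exists t, 0 <= t < 2 * pi /\ p = cis t.
Proof.
case: p => x y; rewrite /circle /= => xy.
have x2 : x ^+ 2 <= 1 by rewrite -xy lerDl sqr_ge0.
have x1 : -1 <= x <= 1 by rewrite -ler_norml -(ler_pXn2r (ltn0Sn 1)) ?nnegrE // expr1n real_normK ?num_real.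
have y2 : y ^+ 2 = 1 - x ^+ 2 by rewrite -xy; ring.
have ax0 := acos_ge0 x1; have axp := acos_lepi x1; have p0 := pi_gt0 R.
have cosx : cos (acos x) = x by rewrite acosK // in_itv.
have sinx : sin (acos x) = `|y| by rewrite sin_acos // -y2 sqrtr_sqr.
have [y0|y0] := leP 0 y.
  exists (acos x); split; first by lra.
  by rewrite /cis cosx sinx ger0_norm.
(* On the lower half-circle [y < 0] excludes [x = 1], so [acos x > 0] and the angle stays below
   [2 * pi]. *)
exists (2 * pi - acos x); split.
  suff : 0 < acos x by lra.
  rewrite acos_gt0 //; case/andP: x1 => -> x1 /=.
  rewrite lt_neqAle x1 andbT; apply/eqP => x1'; move: y2.
  by rewrite x1' expr1n subrr => /eqP; rewrite sqrf_eq0 lt_eqF.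
rewrite /cis mulr_natl addrC cosD2pi sinD2pi cosN sinN cosx sinx.
by rewrite ltr0_norm // opprK.
Qed.

(** Rotation by [- a] reduces to angles counted from 0. *)
Lemma circle_cis_ge a p : circle p -> exists t, a <= t < a + 2 * pi /\ p = cis t.
Proof.
case: p => x y; rewrite /circle /= => xy; have A := cos2Dsin2 a.
have : circle ((x * cos a + y * sin a, y * cos a - x * sin a) : plane R).
  rewrite /circle /=; transitivity ((x ^+ 2 + y ^+ 2) * (cos a ^+ 2 + sin a ^+ 2)).
    by ring.
  by rewrite xy A mulr1.
case/circle_cis_ge0 => t [t0 [cE sE]].
exists (t + a); split; first by lra.
rewrite /cis cosD sinD -cE -sE; congr pair.
  by rewrite -[LHS]mulr1 -A; ring.
by rewrite -[LHS]mulr1 -A; ring.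
Qed.

Lemma circle_cis2 p q : circle p -> circle q -> p <> q ->
  exists a b, [/\ a < b, b < a + 2 * pi, p = cis a & q = cis b].
Proof.
move=> /(circle_cis_ge 0)[a [_ pa]] /(circle_cis_ge a)[b [/andP[ab ba] qb]] pq.
exists a, b; split=> //; rewrite lt_neqAle ab andbT.
by apply/eqP => E; apply: pq; rewrite pa qb E.
Qed.

Lemma circle_closed_disc : @circle R `<=` @closed_disc R.
Proof. by move=> p; rewrite /circle /closed_disc /= => ->. Qed.

Lemma open_closed_disc : @open_disc R `<=` @closed_disc R.
Proof. by move=> p; exact: ltW. Qed.

Lemma closed_disc_cases p : closed_disc p -> open_disc p \/ circle p.
Proof.
rewrite /closed_disc /open_disc /circle /= le_eqVlt.
by move=> /predU1P[|]; [right|left].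
Qed.

Lemma open_disc_not_circle p : open_disc p -> ~ circle p.
Proof. by rewrite /open_disc /circle /= => + E; rewrite E ltxx. Qed.

(** Stewart's identity; its last term gives the convexity of the disc, strict along chords. *)
Lemma segpt_sqr p q t :
  (segpt p q t).1 ^+ 2 + (segpt p q t).2 ^+ 2 =
  (1 - t) * (p.1 ^+ 2 + p.2 ^+ 2) + t * (q.1 ^+ 2 + q.2 ^+ 2) -
  t * (1 - t) * ((q.1 - p.1) ^+ 2 + (q.2 - p.2) ^+ 2).
Proof. by rewrite /segpt /=; ring. Qed.

Lemma dist_gt0 p q : p <> q -> 0 < (q.1 - p.1) ^+ 2 + (q.2 - p.2) ^+ 2.
Proof.
move=> pq; rewrite lt_neqAle addr_ge0 ?sqr_ge0 // andbT eq_sym.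
rewrite paddr_eq0 ?sqr_ge0 // !sqrf_eq0 !subr_eq0; apply/negP.
by case: p q pq => [x y] [x' y'] pq /= /andP[/eqP E /eqP E']; apply: pq; rewrite E E'.
Qed.

Lemma seg_closed_disc p q : closed_disc p -> closed_disc q ->
  seg p q `<=` @closed_disc R.
Proof.
rewrite /closed_disc /= => Dp Dq z [t]; rewrite /= in_itv /= => t01 <-.
rewrite segpt_sqr.
have : 0 <= t * (1 - t) * ((q.1 - p.1) ^+ 2 + (q.2 - p.2) ^+ 2).
  by rewrite mulr_ge0 ?addr_ge0 ?sqr_ge0 ?mulr_ge0 //; lra.
move: (_ * _ * (_ + _)) (_ ^+ 2 + _) (_ ^+ 2 + _) Dp Dq => c x y; nra.
Qed.

Lemma seg_open_disc p q : open_disc p -> open_disc q ->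
  seg p q `<=` @open_disc R.
Proof.
rewrite /open_disc /= => Dp Dq z [t]; rewrite /= in_itv /= => t01 <-.
rewrite segpt_sqr.
have : 0 <= t * (1 - t) * ((q.1 - p.1) ^+ 2 + (q.2 - p.2) ^+ 2).
  by rewrite mulr_ge0 ?addr_ge0 ?sqr_ge0 ?mulr_ge0 //; lra.
move: (_ * _ * (_ + _)) (_ ^+ 2 + _) (_ ^+ 2 + _) Dp Dq => c x y x1 y1.
by have [|] := leP x y; nra.
Qed.

Lemma chord_open_disc p q t : circle p -> circle q -> p <> q -> 0 < t < 1 ->
  open_disc (segpt p q t).
Proof.
rewrite /circle /open_disc /= => Dp Dq /dist_gt0 d t01.
rewrite segpt_sqr Dp Dq; move: (_ + _) d => d d0.
have : 0 < t * (1 - t) * d by rewrite !mulr_gt0 //; lra.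
by move: (_ * d) => e; lra.
Qed.

Lemma side_eq0 p q z : p <> q -> side p q z = 0 -> exists t, z = segpt p q t.
Proof.
move=> /dist_gt0 d sz; set N := _ + _ in d.
(* The parameter of the orthogonal projection of [z] on the line. *)
exists (((z.1 - p.1) * (q.1 - p.1) + (z.2 - p.2) * (q.2 - p.2)) / N).
have N0 : N != 0 by rewrite gt_eqF.
rewrite /segpt [LHS]surjective_pairing; congr pair; apply: (mulfI N0);
  rewrite mulrDr mulrA mulrCA divff // mulr1; apply/eqP; rewrite -subr_eq0.
  have -> : N * z.1 - (N * p.1 + ((z.1 - p.1) * (q.1 - p.1) +
      (z.2 - p.2) * (q.2 - p.2)) * (q.1 - p.1)) = - (q.2 - p.2) * side p q z.
    by rewrite /N /side; ring.
  by rewrite sz mulr0.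
have -> : N * z.2 - (N * p.2 + ((z.1 - p.1) * (q.1 - p.1) +
    (z.2 - p.2) * (q.2 - p.2)) * (q.2 - p.2)) = (q.1 - p.1) * side p q z.
  by rewrite /N /side; ring.
by rewrite sz mulr0.
Qed.

Lemma side_eq0_seg p q z : circle p -> circle q -> p <> q -> closed_disc z ->
  side p q z = 0 -> seg p q z.
Proof.
move=> Cp Cq pq + /(side_eq0 pq)[t zE]; rewrite zE => Dz; exists t => //=.
move: Cp Cq Dz; rewrite /circle /closed_disc /= segpt_sqr => -> ->.
move: (_ + _ ^+ 2) (dist_gt0 pq) => d d0.
rewrite !mulr1 subrK lerBlDr lerDl pmulr_lge0 // in_itv /= => t01.
by apply/andP; split; nra.
Qed.

Lemma side_eq0_circle p q z : circle p -> circle q -> p <> q -> circle z ->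
  side p q z = 0 -> z = p \/ z = q.
Proof.
move=> Cp Cq pq Cz s0; have [t + zE] :=
  side_eq0_seg Cp Cq pq (circle_closed_disc Cz) s0; rewrite /= in_itv /=.
move=> /andP[]; rewrite le_eqVlt => /predU1P[t0 _|t0].
  by left; rewrite -zE -t0 /segpt !mul0r !addr0 -surjective_pairing.
rewrite le_eqVlt => /predU1P[t1|t1].
  by right; rewrite -zE t1 /segpt !mul1r ![_ + (_ - _)]addrC !subrK -surjective_pairing.
have : open_disc z by rewrite -zE; apply: chord_open_disc => //; rewrite t0 t1.
by move=> /open_disc_not_circle.
Qed.

(* Two points of the disc on a common line through the pole of the chord [pq]
   and on a common line through the pole of [uv] coincide: a line through both
   poles is the polar of the crossing point of the chords, and so misses the
   disc. *)
Definition pencil p q z w : R :=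
  (1 - (p.1 * z.1 + p.2 * z.2)) * (1 - (q.1 * w.1 + q.2 * w.2)) -
  (1 - (q.1 * z.1 + q.2 * z.2)) * (1 - (p.1 * w.1 + p.2 * w.2)).

Lemma dot_le1 p z : circle p -> closed_disc z -> p.1 * z.1 + p.2 * z.2 <= 1.
Proof.
rewrite /circle /closed_disc /= => Cp Dz.
have := sqr_ge0 (p.1 - z.1); have := sqr_ge0 (p.2 - z.2); nra.
Qed.

Lemma dot_lt1 p z : open_disc p -> closed_disc z -> p.1 * z.1 + p.2 * z.2 < 1.
Proof.
rewrite /open_disc /closed_disc /= => Cp Dz.
have := sqr_ge0 (p.1 - z.1); have := sqr_ge0 (p.2 - z.2); nra.
Qed.

Lemma dot_geN1 p z : circle p -> closed_disc z -> -1 <= p.1 * z.1 + p.2 * z.2.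
Proof.
rewrite /circle /closed_disc /= => Cp Dz.
have := sqr_ge0 (p.1 + z.1); have := sqr_ge0 (p.2 + z.2); nra.
Qed.

(** The factor attached to [p] vanishes at [p] itself, which leaves one product of known sign. Such
    signs serve as boundary values on the grid below. *)
Lemma pencil_le0 p q w : circle p -> circle q -> closed_disc w ->
  pencil p q p w <= 0.
Proof.
move=> Cp Cq Dw; rewrite /pencil -!expr2 Cp subrr mul0r sub0r oppr_le0.
by rewrite mulr_ge0 // subr_ge0 dot_le1 //; apply: circle_closed_disc.
Qed.

Lemma pencil_ge0 p q w : circle p -> circle q -> closed_disc w ->
  0 <= pencil p q q w.
Proof.
move=> Cp Cq Dw; rewrite /pencil -!expr2 Cq subrr mul0r subr0.
by rewrite mulr_ge0 // subr_ge0 dot_le1 //; apply: circle_closed_disc.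
Qed.

Lemma pencilC p q z w : pencil p q z w = - pencil p q w z.
Proof. by rewrite /pencil; ring. Qed.

Lemma pencilN p q z w : pencil p q z w = - pencil q p z w.
Proof. by rewrite /pencil; ring. Qed.

Lemma pencil_inj p q u v z w :
  circle p -> circle q -> circle u -> circle v -> p <> q ->
  side p q u < 0 -> 0 < side p q v -> closed_disc z -> closed_disc w ->
  pencil p q z w = 0 -> pencil u v z w = 0 -> z = w.
Proof.
move=> Cp Cq Cu Cv pq su sv Dz Dw.
(* Parameter at which the segment from [u] to [v] crosses the line [pq]: the affine function
   [side p q] vanishes there. *)
pose b := - side p q u / (side p q v - side p q u).
have d0 : 0 < side p q v - side p q u by lra.
have b01 : 0 < b < 1.
  by rewrite /b ltr_pdivlMr // ltr_pdivrMr // mul0r mul1r; lra.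
have uv : u <> v by move=> E; move: su sv; rewrite E; lra.
have OD := chord_open_disc Cu Cv uv b01.
have sO : side p q (segpt u v b) = 0.
  have -> : side p q (segpt u v b) = side p q u + b * (side p q v - side p q u).
    by rewrite /side /segpt /=; ring.
  by rewrite /b -mulrA mulVf ?gt_eqF // mulr1 subrr.
have [a OE] := side_eq0 pq sO.
have {sO b01} [b0 b1] := andP b01.
(* The crossing point is interior to the disc, hence strictly between [p] and [q]. *)
have a01 : 0 < a * (1 - a).
  move: OD; rewrite OE /open_disc /= segpt_sqr Cp Cq.
  have := dist_gt0 pq; move: (_ + _ ^+ 2) => d d1.
  rewrite !mulr1 subrK ltrBlDr ltrDl pmulr_lgt0 //.
have a0 : 0 < a by nra.
have a1 : a < 1 by nra.
(* For [x] on the circle, [T x] vanishes on the tangent at [x]. Normalised by the form of the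
   crossing point, which is positive on the disc, the two pencil equations make the values of all
   four forms at [z] and [w] proportional with one common factor. *)
pose T x y : R := 1 - (x.1 * y.1 + x.2 * y.2).
have TO y : T (segpt p q a) y = (1 - a) * T p y + a * T q y.
  by rewrite /T /segpt /=; ring.
have TO' y : T (segpt p q a) y = (1 - b) * T u y + b * T v y.
  by rewrite -OE /T /segpt /=; ring.
have TO_gt0 y : closed_disc y -> 0 < T (segpt p q a) y.
  by move=> Dy; rewrite -OE /T subr_gt0 dot_lt1.
have := TO_gt0 _ Dz; have := TO_gt0 _ Dw.
have := TO z; have := TO w; have := TO' z; have := TO' w.
move: (T (segpt p q a) z) (T (segpt p q a) w) => S S' Sw' Sz' Sw Sz S'0 S0 H1 H2.
have {}H1 : T p z * T q w = T q z * T p w by apply/eqP; rewrite -subr_eq0; apply/eqP.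
have {}H2 : T u z * T v w = T v z * T u w by apply/eqP; rewrite -subr_eq0; apply/eqP.
have Ep : T p z * S' = T p w * S by rewrite Sw Sz; ring: H1.
have Eq : T q z * S' = T q w * S by rewrite Sw Sz; ring: H1.
have Eu : T u z * S' = T u w * S by rewrite Sw' Sz'; ring: H2.
have D0 : side p q u != 0 by rewrite lt_eqF.
(* A nonzero constant is a combination of three of the forms, so the factor of proportionality is
   1. *)
have TD y : side p q u = (q.1 * u.2 - q.2 * u.1) * T p y +
    (u.1 * p.2 - u.2 * p.1) * T q y + (p.1 * q.2 - p.2 * q.1) * T u y.
  by rewrite /side /T; ring.
have SS : S' = S.
  apply: (mulfI D0); by rewrite {1}(TD z) {1}(TD w) !mulrDl -!mulrA Ep Eq Eu.
have S'N : S' != 0 by rewrite gt_eqF.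
move: Ep Eq Eu; rewrite -SS => /(mulIf S'N) Ep /(mulIf S'N) Eq /(mulIf S'N) Eu.
move: Ep Eq Eu; rewrite /T => Ep Eq Eu.
have {}Ep : p.1 * z.1 + p.2 * z.2 = p.1 * w.1 + p.2 * w.2 by lra.
have {}Eq : q.1 * z.1 + q.2 * z.2 = q.1 * w.1 + q.2 * w.2 by lra.
have {}Eu : u.1 * z.1 + u.2 * z.2 = u.1 * w.1 + u.2 * w.2 by lra.
rewrite [z]surjective_pairing [w]surjective_pairing.
congr pair; apply: (mulfI D0); apply/eqP; rewrite -subr_eq0.
  have -> : side p q u * z.1 - side p q u * w.1 =
      (u.2 - p.2) * ((q.1 * z.1 + q.2 * z.2) - (p.1 * z.1 + p.2 * z.2) -
        ((q.1 * w.1 + q.2 * w.2) - (p.1 * w.1 + p.2 * w.2))) -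
      (q.2 - p.2) * ((u.1 * z.1 + u.2 * z.2) - (p.1 * z.1 + p.2 * z.2) -
        ((u.1 * w.1 + u.2 * w.2) - (p.1 * w.1 + p.2 * w.2))).
    by rewrite /side; ring.
  by rewrite Ep Eq Eu !subrr !mulr0 subrr.
have -> : side p q u * z.2 - side p q u * w.2 =
    (q.1 - p.1) * ((u.1 * z.1 + u.2 * z.2) - (p.1 * z.1 + p.2 * z.2) -
      ((u.1 * w.1 + u.2 * w.2) - (p.1 * w.1 + p.2 * w.2))) -
    (u.1 - p.1) * ((q.1 * z.1 + q.2 * z.2) - (p.1 * z.1 + p.2 * z.2) -
      ((q.1 * w.1 + q.2 * w.2) - (p.1 * w.1 + p.2 * w.2))).
  by rewrite /side; ring.
by rewrite Ep Eq Eu !subrr !mulr0 subrr.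
Qed.

End CircleGeometry.

(** * Crossing of two continua in the disc *)

(* A discrete Poincare-Miranda theorem.  The edges along which [X] holds and [Y]
   changes are counted modulo 2: a cell on which [X] or [Y] is constant has an
   even number of them, so without a mixed cell the parity would be the same on
   all columns of the grid. *)
Lemma grid_mixed_cell (X Y : nat -> nat -> bool) (m n : nat) :
  (forall j, X 0%N j = false) -> (forall j, X m j) ->
  (forall i, Y i 0%N = false) -> (forall i, Y i n) ->
  exists i j, [/\ (i < m)%N, (j < n)%N,
    exists a b c d, [/\ (a <= 1)%N, (b <= 1)%N, (c <= 1)%N & (d <= 1)%N] /\
      (X (i + a)%N (j + b)%N /\ ~~ X (i + c)%N (j + d)%N) &
    exists a b c d, [/\ (a <= 1)%N, (b <= 1)%N, (c <= 1)%N & (d <= 1)%N] /\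
      (Y (i + a)%N (j + b)%N /\ ~~ Y (i + c)%N (j + d)%N)].
Proof.
move=> X0 Xm Y0 Yn; apply: contrapT => H.
pose cst (Z : nat -> nat -> bool) i j := [&& Z i j == Z i.+1 j,
  Z i j == Z i j.+1 & Z i j == Z i.+1 j.+1].
have cstP Z i j : ~~ cst Z i j -> exists a b c d,
    [/\ (a <= 1)%N, (b <= 1)%N, (c <= 1)%N & (d <= 1)%N] /\
    (Z (i + a)%N (j + b)%N /\ ~~ Z (i + c)%N (j + d)%N).
  move=> nZ; have [a [b [[a1 b1] E]]] : exists a b, ((a <= 1)%N /\ (b <= 1)%N) /\
      Z i j != Z (i + a)%N (j + b)%N.
    move: nZ; rewrite /cst !negb_and => /or3P[] E.
    - by exists 1%N, 0%N; rewrite addn1 addn0.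
    - by exists 0%N, 1%N; rewrite addn1 addn0.
    - by exists 1%N, 1%N; rewrite !addn1.
  have [Zij|/negPf Zij] := boolP (Z i j); rewrite Zij in E.
    exists 0%N, 0%N, a, b; split=> //; rewrite !addn0 Zij; split=> //.
  exists a, b, 0%N, 0%N; split=> //; rewrite !addn0 Zij; split=> //.
  by case: (Z (i + a)%N _) E.
have cell i j : (i < m)%N -> (j < n)%N -> cst X i j || cst Y i j.
  move=> im jn; apply/negP => /negP; rewrite negb_or => /andP[/cstP hX /cstP hY].
  by apply: H; exists i, j.
pose e i j i' j' := [&& X i j, X i' j' & Y i j (+) Y i' j'].
(* [V i j] is the parity of the counted edges among the first [j] edges of column [i]. *)
pose V := fix V i j := if j is j'.+1 then V i j' (+) e i j' i j else false.
(* Summing over the cells of a strip cancels the inner horizontal edges; the bottom edge does not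
   count since [Y] is constant there, so only the edge at height [j] remains. *)
have step i j : (i < m)%N -> (j <= n)%N -> V i j (+) V i.+1 j = e i j i.+1 j.
  move=> im; elim: j => [_|j IH jn]; first by rewrite /= /e !Y0 !andbF.
  have := cell i j im jn; have := IH (ltnW jn); rewrite /= /e /cst.
  move: (V i j) (V i.+1 j); do 2!case; case: (X i j); case: (X i.+1 j);
    case: (X i j.+1); case: (X i.+1 j.+1); case: (Y i j); case: (Y i.+1 j);
    case: (Y i j.+1); case: (Y i.+1 j.+1); by [].
have Vcst i : (i <= m)%N -> V i n = false.
  elim: i => [_|i IH im].
    by elim: n {Yn H cell step} => //= j ->; rewrite /e X0.
  by have := step i n im (leqnn n); rewrite IH ?(ltnW im) // /e !Yn !andbF.
(* On the last column [X] always holds, so the parity telescopes to [Y]. It is odd at height [n],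
   against the even parity carried over from the first column. *)
have Vm j : V m j = Y m j.
  by elim: j => [|j IH] /=; [rewrite Y0|rewrite IH /e !Xm /= addbA addbb].
by have := Vcst m (leqnn m); rewrite Vm Yn.
Qed.

Definition chain (R : realType) (A : set (plane R)) (e : R) (x y : plane R)
    (m : nat) (f : nat -> plane R) :=
  [/\ f 0%N = x, f m = y, forall i, (i <= m)%N -> A (f i) &
      forall i, (i < m)%N -> ball (f i) e (f i.+1)].

(** The points reachable from [x] by [e]-chains in [A] form a nonempty, relatively open and closed
    subset. *)
Lemma connected_chain (R : realType) (A : set (plane R)) (e : R) x y :
  0 < e -> connected A -> A x -> A y -> exists m f, chain A e x y m f.
Proof.
move=> e0 cA Ax Ay.
pose C := [set z | A z /\ exists m f, chain A e x z m f].
have ext z z' : C z -> A z' -> ball z e z' -> C z'.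
  move=> [Az [m [f [f0 fm fA fe]]]] Az' zz'; split=> //.
  exists m.+1, (fun i => if (i <= m)%N then f i else z'); split=> //.
  - by rewrite ltnn.
  - by move=> i _; case: ifPn => [/fA|].
  - move=> i im1; have im : (i <= m)%N by [].
    rewrite im; case: ifPn => [|nim]; first exact: fe.
    have -> : i = m by apply/eqP; rewrite eqn_leq im leqNgt.
    by rewrite fm.
have bo (z : plane R) : open (ball z e)^° by exact: open_interior.
have bi (z : plane R) : (ball z e)^° z by apply: nbhsx_ballx.
suff CA : C = A by have : C y by [rewrite CA]; case.
apply: cA.
- by exists x; split=> //; exists 0%N, (fun=> x); split=> //.
- exists (\bigcup_(z in C) (ball z e)^°); first exact: bigcup_open.
  apply/seteqP; split=> [z Cz|z [Az [z' Cz' /interior_subset zz']]].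
    by split; [case: Cz|exists z].
  exact: ext zz'.
- exists (~` \bigcup_(z in A `\` C) (ball z e)^°).
    by apply: open_closedC; exact: bigcup_open.
  apply/seteqP; split=> [z Cz|z [Az nz]].
    split; first by case: Cz.
    move=> [z' [Az' nCz'] /interior_subset /ball_sym zz'].
    by apply: nCz'; exact: ext zz'.
  by apply: contrapT => nCz; apply: nz; exists z.
Qed.

(** Each factor is at most 2 in absolute value and moves by at most [2 * e], so each of the two
    products moves by at most [8 * e]. *)
Lemma pencil_step (R : realType) (p q z w z' w' : plane R) (e : R) :
  circle p -> circle q -> closed_disc z -> closed_disc w -> closed_disc z' ->
  closed_disc w' -> `|z.1 - z'.1| <= e -> `|z.2 - z'.2| <= e ->
  `|w.1 - w'.1| <= e -> `|w.2 - w'.2| <= e ->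
  `|pencil p q z w - pencil p q z' w'| <= 16 * e.
Proof.
move=> Cp Cq Dz Dw Dz' Dw' z1 z2 w1 w2.
have T2 (a b : plane R) : circle a -> closed_disc b ->
    `|1 - (a.1 * b.1 + a.2 * b.2)| <= 2.
  move=> Ca Db; have := dot_le1 Ca Db; have := dot_geN1 Ca Db.
  by rewrite ler_norml => ? ?; apply/andP; split; lra.
have c1 (a : plane R) : circle a -> `|a.1| <= 1 /\ `|a.2| <= 1.
  rewrite /circle /= => Ca; rewrite !ler_norml.
  have := sqr_ge0 a.1; have := sqr_ge0 a.2.
  by split; apply/andP; split; nra.
have TD (a b c : plane R) : circle a -> `|b.1 - c.1| <= e -> `|b.2 - c.2| <= e ->
    `|1 - (a.1 * b.1 + a.2 * b.2) - (1 - (a.1 * c.1 + a.2 * c.2))| <= 2 * e.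
  move=> /c1[a1 a2] b1 b2.
  have -> : 1 - (a.1 * b.1 + a.2 * b.2) - (1 - (a.1 * c.1 + a.2 * c.2)) =
    - (a.1 * (b.1 - c.1) + a.2 * (b.2 - c.2)) by ring.
  rewrite normrN (le_trans (ler_normD _ _)) // !normrM mulr_natl mulr2n.
  by rewrite lerD // -[leRHS]mul1r ler_pM.
have PD (a b a' b' : R) : `|a| <= 2 -> `|b'| <= 2 -> `|a - a'| <= 2 * e ->
    `|b - b'| <= 2 * e -> `|a * b - a' * b'| <= 8 * e.
  move=> a2 b2 aa bb.
  have -> : a * b - a' * b' = a * (b - b') + (a - a') * b' by ring.
  rewrite (le_trans (ler_normD _ _)) // !normrM.
  have : `|a| * `|b - b'| <= 2 * (2 * e) by rewrite ler_pM.
  have : `|a - a'| * `|b'| <= (2 * e) * 2 by rewrite ler_pM.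
  by lra.
rewrite /pencil.
set a := 1 - _; set b := 1 - _; set c := 1 - _; set d := 1 - _.
set a' := 1 - _; set b' := 1 - _; set c' := 1 - _; set d' := 1 - _.
have -> : a * b - c * d - (a' * b' - c' * d') =
  (a * b - a' * b') - (c * d - c' * d') by ring.
rewrite (le_trans (ler_normB _ _)) //.
have : `|a * b - a' * b'| <= 8 * e by apply: PD; rewrite ?T2 ?TD.
have : `|c * d - c' * d'| <= 8 * e by apply: PD; rewrite ?T2 ?TD.
by lra.
Qed.

(** If [A] and [B] were disjoint, the two pencils would have no common zero on the compact product,
    so the sum [G] of their squares would be bounded below by some [mu > 0]. Fine chains in [A] and
    [B] index a grid, and a mixed cell yields a pair at which both pencils are nearly zero. *)
Lemma crossing (R : realType) (A B : set (plane R)) (p q u v : plane R) :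
  A `<=` @closed_disc R -> B `<=` @closed_disc R -> compact A -> compact B ->
  connected A -> connected B -> A p -> A q -> B u -> B v ->
  circle p -> circle q -> circle u -> circle v -> p <> q ->
  side p q u < 0 -> 0 < side p q v -> A `&` B !=set0.
Proof.
move=> AD BD kA kB cA cB Ap Aq Bu Bv Cp Cq Cu Cv pq su sv.
apply: contrapT => AB0.
pose G (x : plane R * plane R) : R :=
  pencil p q x.1 x.2 ^+ 2 + pencil v u x.1 x.2 ^+ 2.
have cG : continuous G.
  have c11 : continuous (fun x : plane R * plane R => x.1.1).
    by move=> x; apply: cvg_comp; apply: cvg_fst.
  have c12 : continuous (fun x : plane R * plane R => x.1.2).
    by move=> x; apply: cvg_comp; [apply: cvg_fst|apply: cvg_snd].
  have c21 : continuous (fun x : plane R * plane R => x.2.1).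
    by move=> x; apply: cvg_comp; [apply: cvg_snd|apply: cvg_fst].
  have c22 : continuous (fun x : plane R * plane R => x.2.2).
    by move=> x; apply: cvg_comp; apply: cvg_snd.
  have cl (a b : R) (f g : plane R * plane R -> R) : continuous f -> continuous g ->
      continuous (fun x => 1 - (a * f x + b * g x)).
    move=> cf cg x; apply: cvgB; first exact: cvg_cst.
    by apply: cvgD; apply: cvgM; (try exact: cvg_cst); [exact: cf|exact: cg].
  have cp (a b : plane R) : continuous (fun x : plane R * plane R =>
      pencil a b x.1 x.2).
    move=> x; apply: cvgB.
      exact: cvgM (cl a.1 a.2 _ _ c11 c12 x) (cl b.1 b.2 _ _ c21 c22 x).
    exact: cvgM (cl b.1 b.2 _ _ c11 c12 x) (cl a.1 a.2 _ _ c21 c22 x).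
  move=> x; apply: cvgD; rewrite expr2.
    exact: (cvgM (cp p q x) (cp p q x)).
  exact: (cvgM (cp v u x) (cp v u x)).
have : compact (G @` (A `*` B)).
  apply: continuous_compact; first exact: continuous_subspaceT.
  exact: compact_setX.
move=> /(compact_closed (@Rhausdorff R)) clG.
have G0 : (~` (G @` (A `*` B))) 0.
  move=> [[z w] [/= Az Bw]]; rewrite /G /= => /eqP.
  rewrite paddr_eq0 ?sqr_ge0 // !sqrf_eq0 => /andP[/eqP F1 /eqP F2].
  apply: AB0; exists z; split=> //.
  have {}F2 : pencil u v z w = 0 by rewrite pencilN F2 oppr0.
  by rewrite (pencil_inj Cp Cq Cu Cv pq su sv (AD _ Az) (BD _ Bw) F1 F2).
have /nbhs_ballP[mu mu0 muG] : nbhs (0 : R) (~` (G @` (A `*` B))).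
  by apply: open_nbhs_nbhs; split=> //; exact: closed_openC.
have {clG G0}Gmu z w : A z -> B w -> mu <= G (z, w).
  move=> Az Bw; rewrite leNgt; apply/negP => Gm; apply: (muG (G (z, w))).
    rewrite /ball /= sub0r normrN ger0_norm //.
    by rewrite /G addr_ge0 ?sqr_ge0.
  by exists (z, w).
(* With [e <= 1] and [e <= mu / 1024], twice the square of [16 * e] is at most
   [512 * e <= mu / 2]. *)
have [e [e0 emu]] : exists e, 0 < e /\ 2 * (16 * e) ^+ 2 < mu.
  have d0 : 0 < mu / 1024 by have : 0 < mu := mu0; lra.
  have d1 : mu / 1024 * 1024 = mu by lra.
  move: (mu / 1024) d0 d1 => d d0 d1.
  have [e [e0 e1 ed]] : exists e, [/\ 0 < e, e <= 1 & e <= d].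
    by exists (Num.min 1 d); rewrite lt_min ltr01 d0 !ge_min !lexx orbT.
  exists e; split=> //.
  have : e * e <= 1 * d by rewrite ler_pM // ltW.
  by rewrite -d1 exprMn expr2; lra.
have [m [f [f0 fm fA fe]]] := connected_chain e0 cA Ap Aq.
have [n [g [g0 gn gB ge]]] := connected_chain e0 cB Bu Bv.
(* The boundary values are imposed because the pencils have only weak signs there; the imposed
   values agree with these signs. The order [v u] makes [Y] pass from false at [u] to true at
   [v]. *)
pose X i j := (i == m) || (i != 0%N) && (0 <= pencil p q (f i) (g j)).
pose Y i j := (j == n) || (j != 0%N) && (0 <= pencil v u (f i) (g j)).
have m0 : 0%N != m by apply/eqP => m0; apply: pq; rewrite -f0 -fm -m0.
have n0 : 0%N != n.
  by apply/eqP => n0; move: su sv; rewrite -g0 -gn -n0; lra.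
have [||||i [j [im jn [a [b [c [d [[a1 b1 c1 d1] [XT XF]]]]]]
    [a' [b' [c' [d' [[a1' b1' c1' d1'] [YT YF]]]]]]]]] := @grid_mixed_cell X Y m n.
- by move=> j; rewrite /X eqxx (negPf m0).
- by move=> j; rewrite /X eqxx.
- by move=> i; rewrite /Y eqxx (negPf n0).
- by move=> i; rewrite /Y eqxx.
have nearf k h (N : nat) (s : nat -> plane R) : (forall i, (i < N)%N -> ball (s i) e (s i.+1)) ->
    (k < N)%N -> (h <= 1)%N ->
    `|(s k).1 - (s (k + h)%N).1| <= e /\ `|(s k).2 - (s (k + h)%N).2| <= e.
  move=> se kN; case: h => [_|[_|//]].
    by rewrite addn0 !subrr normr0 ltW.
  by rewrite addn1; have [/= s1 s2] := se _ kN; split; exact: ltW.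
have fD k : (k <= m)%N -> closed_disc (f k) by move=> /fA /AD.
have gD k : (k <= n)%N -> closed_disc (g k) by move=> /gB /BD.
have lem k h N : (k < N)%N -> (h <= 1)%N -> (k + h <= N)%N.
  by move=> kN; case: h => [_|[_|//]]; rewrite ?addn0 ?addn1 // ltnW.
have bnd (x y : plane R) k h : circle x -> circle y -> (k <= 1)%N -> (h <= 1)%N ->
    `|pencil x y (f i) (g j) - pencil x y (f (i + k)%N) (g (j + h)%N)| <= 16 * e.
  move=> Cx Cy k1 h1; have [? ?] := nearf _ _ _ _ fe im k1.
  have [? ?] := nearf _ _ _ _ ge jn h1.
  by apply: pencil_step => //; (apply: fD || apply: gD); (exact: ltnW || exact: lem).
have XTp k h : (k <= 1)%N -> (h <= 1)%N -> X (i + k)%N (j + h)%N ->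
    0 <= pencil p q (f (i + k)%N) (g (j + h)%N).
  move=> k1 h1; rewrite /X => /orP[/eqP ->|/andP[]//].
  by rewrite fm; apply: pencil_ge0 => //; exact/gD/lem.
have XFp k h : (k <= 1)%N -> (h <= 1)%N -> ~~ X (i + k)%N (j + h)%N ->
    pencil p q (f (i + k)%N) (g (j + h)%N) <= 0.
  move=> k1 h1; rewrite /X negb_or => /andP[_]; rewrite negb_and negbK.
  move=> /orP[/eqP ->|]; first by rewrite f0; apply: pencil_le0 => //; exact/gD/lem.
  by rewrite -ltNge => /ltW.
have YTp k h : (k <= 1)%N -> (h <= 1)%N -> Y (i + k)%N (j + h)%N ->
    0 <= pencil v u (f (i + k)%N) (g (j + h)%N).
  move=> k1 h1; rewrite /Y => /orP[/eqP ->|/andP[]//].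
  by rewrite gn pencilC oppr_ge0; apply: pencil_le0 => //; exact/fD/lem.
have YFp k h : (k <= 1)%N -> (h <= 1)%N -> ~~ Y (i + k)%N (j + h)%N ->
    pencil v u (f (i + k)%N) (g (j + h)%N) <= 0.
  move=> k1 h1; rewrite /Y negb_or => /andP[_]; rewrite negb_and negbK.
  move=> /orP[/eqP ->|]; first by rewrite g0 pencilC oppr_le0; apply: pencil_ge0 => //; exact/fD/lem.
  by rewrite -ltNge => /ltW.
(* In the mixed cell each pencil takes both weak signs, so its value at the corner [(i, j)] is at
   most [16 * e] in absolute value. *)
have := Gmu _ _ (fA _ (ltnW im)) (gB _ (ltnW jn)).
rewrite /G /=.
have {}XTp := XTp _ _ a1 b1 XT; have {}XFp := XFp _ _ c1 d1 XF.
have {}YTp := YTp _ _ a1' b1' YT; have {}YFp := YFp _ _ c1' d1' YF.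
have := bnd p q _ _ Cp Cq a1 b1; have := bnd p q _ _ Cp Cq c1 d1.
have := bnd v u _ _ Cv Cu a1' b1'; have := bnd v u _ _ Cv Cu c1' d1'.
rewrite !ler_norml => /andP[? ?] /andP[? ?] /andP[? ?] /andP[? ?].
have sq (x : R) : `|x| <= 16 * e -> x ^+ 2 <= (16 * e) ^+ 2.
  by move=> xe; rewrite -(real_normK (num_real x)) ler_pXn2r // nnegrE //; lra.
have : pencil p q (f i) (g j) ^+ 2 <= (16 * e) ^+ 2.
  by apply: sq; rewrite ler_norml; apply/andP; split; lra.
have : pencil v u (f i) (g j) ^+ 2 <= (16 * e) ^+ 2.
  by apply: sq; rewrite ler_norml; apply/andP; split; lra.
by move: emu; lra.
Qed.

(** * Topology of the disc, transition maps, and crosscuts made of two rays *)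

Section DiscTopology.
Variable R : realType.
Implicit Types (p q u v z w : plane R) (a b t : R).

Lemma plane_hausdorff : hausdorff_space (plane R).
Proof. exact: norm_hausdorff. Qed.

Lemma continuous_sqr_norm :
  continuous (fun z => z.1 ^+ 2 + z.2 ^+ 2 : R).
Proof.
move=> z; apply: cvgD; rewrite expr2.
  by apply: cvgM; exact: cvg_fst.
by apply: cvgM; exact: cvg_snd.
Qed.

Lemma open_open_disc : open (@open_disc R).
Proof.
rewrite (_ : @open_disc R = (fun z => z.1 ^+ 2 + z.2 ^+ 2) @^-1` [set x | x < 1]) //.
by apply: open_comp; [move=> z _; exact: continuous_sqr_norm|exact: open_lt].
Qed.

Lemma closed_closed_disc : closed (@closed_disc R).
Proof.
rewrite (_ : @closed_disc R = (fun z => z.1 ^+ 2 + z.2 ^+ 2) @^-1` [set x | x <= 1]) //.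
by apply: closed_comp; [move=> z _; exact: continuous_sqr_norm|exact: closed_le].
Qed.

Lemma closed_disc_box z : closed_disc z -> `|z.1| <= 1 /\ `|z.2| <= 1.
Proof.
rewrite /closed_disc /= => Dz; rewrite !ler_norml.
by have := sqr_ge0 z.1; have := sqr_ge0 z.2; split; apply/andP; split; nra.
Qed.

Lemma compact_box (c : R) : compact (`[- c, c] `*` `[- c, c] : set (plane R)).
Proof. by apply: compact_setX; exact: segment_compact. Qed.

Lemma compact_closed_disc : compact (@closed_disc R).
Proof.
apply: (subclosed_compact closed_closed_disc (@compact_box 1)) => z /closed_disc_box.
by rewrite !ler_norml /= !in_itv.
Qed.

Lemma segpt0 p q : segpt p q 0 = p.
Proof. by rewrite /segpt !mul0r !addr0 -surjective_pairing. Qed.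

Lemma segpt1 p q : segpt p q 1 = q.
Proof.
by rewrite /segpt !mul1r ![_ + (_ - _)]addrC !subrK -surjective_pairing.
Qed.

Lemma seg_left p q : seg p q p.
Proof. by exists 0; rewrite ?segpt0 //= in_itv /= lexx ler01. Qed.

Lemma seg_right p q : seg p q q.
Proof. by exists 1; rewrite ?segpt1 //= in_itv /= lexx ler01. Qed.

Lemma cvg_plane (T : Type) (F : set_system T) (FF : Filter F) (f g : T -> R) a b :
  f @ F --> a -> g @ F --> b -> (fun x => (f x, g x) : plane R) @ F --> ((a, b) : plane R).
Proof. by move=> fa gb; exact: (cvg_pair fa gb). Qed.

Lemma continuous_segpt p q : continuous (segpt p q).
Proof.
move=> t; apply: cvg_plane; apply: cvgD; (try exact: cvg_cst);
  by apply: cvgM; [exact: cvg_id|exact: cvg_cst].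
Qed.

Lemma compact_seg p q : compact (seg p q).
Proof.
apply: continuous_compact; last exact: segment_compact.
by apply: continuous_subspaceT; exact: continuous_segpt.
Qed.

Lemma connected_seg p q : connected (seg p q).
Proof.
apply: connected_continuous_connected; first exact: segment_connected.
by apply: continuous_subspaceT; exact: continuous_segpt.
Qed.

Lemma seg_ball w (e : R) p q : ball w e p -> ball w e q ->
  seg p q `<=` ball w e.
Proof.
move=> [/= p1 p2] [/= q1 q2] z [t]; rewrite /= in_itv /= => /andP[t0 t1] <-.
have aux (x y c : R) : `|c - x| < e -> `|c - y| < e ->
    `|c - (x + t * (y - x))| < e.
  have [->|/eqP t10] := eqVneq t 1; first by rewrite mul1r [x + _]addrC subrK.
  move=> cx cy.
  have -> : c - (x + t * (y - x)) = (1 - t) * (c - x) + t * (c - y) by ring.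
  rewrite (le_lt_trans (ler_normD _ _)) // !normrM (ger0_norm t0).
  rewrite (@ger0_norm _ (1 - t)) ?subr_ge0 //.
  have t1' : t < 1 by rewrite lt_neqAle t1 andbT; apply/eqP.
  move: `|_| `|_| cx cy => A B cx cy; nra.
by split; apply: aux.
Qed.

(** Moving the point slightly towards the centre puts it in the open disc. *)
Lemma closure_open_disc z : closed_disc z -> closure (@open_disc R) z.
Proof.
move=> Dz B; have /(_ B) := @continuous_segpt z 0 0; rewrite segpt0 => + Bz.
move=> /(_ Bz)/nbhs_ballP[e /= e0 eB].
pose t := Num.min (1/2) (e / 2).
have t0 : 0 < t by rewrite lt_min !divr_gt0.
have te : t < e.
  by rewrite (@le_lt_trans _ _ (e / 2)) ?ge_min ?lexx ?orbT //; lra.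
have t1 : t <= 1/2 by rewrite ge_min lexx.
exists (segpt z 0 t); split; last first.
  by apply: eB; rewrite /ball /= sub0r normrN gtr0_norm.
move: Dz; rewrite /closed_disc /open_disc /mkset segpt_sqr /= => Dz.
have := sqr_ge0 z.1; have := sqr_ge0 z.2.
by rewrite !sub0r !sqrrN !expr0n /=; nra.
Qed.

Lemma within_open_disc_proper z : closed_disc z ->
  ProperFilter (within (@open_disc R) (nbhs z)).
Proof.
move=> Dz; apply: Build_ProperFilter_ex => A.
rewrite /within /= => /(closure_open_disc Dz)[w [Dw]] /(_ Dw) Aw.
by exists w.
Qed.

(** Mutually inverse homeomorphisms of the open disc, given as total maps with arbitrary values
    outside it. *)
Definition homeo_pair (h h' : plane R -> plane R) : Prop :=
  [/\ forall z, open_disc z -> open_disc (h z),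
      forall z, open_disc z -> {for z, continuous h},
      forall z, open_disc z -> {for z, continuous h'},
      forall z, open_disc z -> h' (h z) = z &
      forall z, open_disc z -> open_disc (h' z) /\ h (h' z) = z].

Lemma compactification_continuous (phi : plane R -> plane R) :
  compactification phi -> continuous phi.
Proof. by move=> [[c _] _]; exact/continuous_subspace_setT. Qed.

Lemma compactification_open_disc (phi : plane R -> plane R) x :
  compactification phi -> open_disc (phi x).
Proof. by move=> [_ <-]; exists x. Qed.

(** [h] is [psi] after the inverse of [phi]. As the disc is open, continuity of the inverses within
    it is continuity at its points. *)
Lemma transition (phi psi : plane R -> plane R) :
  compactification phi -> compactification psi ->
  exists h h', [/\ homeo_pair h h', forall x, h (phi x) = psi x &
                   forall x, h' (psi x) = phi x].
Proof.
move=> Cphi Cpsi.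
have cphi := compactification_continuous Cphi.
have cpsi := compactification_continuous Cpsi.
have := Cphi; have := Cpsi.
move=> [[_ [g' [cg' g'K]]] psiD] [[_ [g [cg gK]]] phiD].
rewrite phiD in cg; rewrite psiD in cg'.
have {}cg z : open_disc z -> {for z, continuous g}.
  by move: cg; rewrite (continuous_open_subspace _ open_open_disc) => /(_ z);
    rewrite inE.
have {}cg' z : open_disc z -> {for z, continuous g'}.
  by move: cg'; rewrite (continuous_open_subspace _ open_open_disc) => /(_ z);
    rewrite inE.
have phig z : open_disc z -> phi (g z) = z.
  by rewrite -{1}phiD => -[x _ <-]; rewrite gK.
have psig z : open_disc z -> psi (g' z) = z.
  by rewrite -{1}psiD => -[x _ <-]; rewrite g'K.
exists (psi \o g), (phi \o g'); split; last 2 first.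
- by move=> x /=; rewrite gK.
- by move=> x /=; rewrite g'K.
split=> z Dz /=.
- exact: compactification_open_disc.
- by apply: continuous_comp; [exact: cg|exact: cpsi].
- by apply: continuous_comp; [exact: cg'|exact: cphi].
- by rewrite g'K // phig.
- by split; [exact: compactification_open_disc|rewrite gK // psig].
Qed.

(** The crosscut: two rays and a segment between their origins, handled as a connected set and not
    as an arc. *)
Definition ray_bridge (r s : R -> plane R) : set (plane R) :=
  r @` @halfline R `|` seg (r 0) (s 0) `|` s @` @halfline R.

Lemma connected_halfline : connected (@halfline R).
Proof.
rewrite (_ : @halfline R = [set` `[0, +oo[]); last first.
  by apply/seteqP; split=> t; rewrite /= in_itv /= andbT.
exact/connected_intervalP/interval_is_interval.
Qed.

Lemma connected_ray_bridge r s :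
  {within @halfline R, continuous r} -> {within @halfline R, continuous s} ->
  connected (ray_bridge r s).
Proof.
move=> cr cs; have c0 : halfline (0 : R) by rewrite /halfline /=.
apply: connectedU; [|apply: connectedU|].
- by exists (s 0); split; [right; exact: seg_right|exists 0].
- by exists (r 0); split; [exists 0|exact: seg_left].
- by apply: connected_continuous_connected => //; exact: connected_halfline.
- exact: connected_seg.
- by apply: connected_continuous_connected => //; exact: connected_halfline.
Qed.

(** A compact initial part stays in the open disc, and the tail stays in a neighbourhood of [p]
    disjoint from one of [w]. *)
Lemma ray_far (phi : plane R -> plane R) r p w : compactification phi ->
  {within @halfline R, continuous r} -> tends phi r p -> circle w -> w <> p ->
  ~ closure (phi @` (r @` @halfline R)) w.
Proof.
move=> Cphi cr rp Cw wp.
have := plane_hausdorff; rewrite open_hausdorff => /(_ p w).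
rewrite eq_sym => /(_ (introN eqP wp))[[U V] [/= /[!inE] pU wV] [oU oV UV]].
have [M [_ rM]] : \forall t \near +oo, U (phi (r t)).
  by apply: rp; apply: open_nbhs_nbhs.
pose N := Num.max M 0.
have kK : compact (phi @` (r @` `[0, N])).
  apply: continuous_compact.
    by apply: continuous_subspaceT; exact: compactification_continuous.
  apply: continuous_compact; last exact: segment_compact.
  apply: continuous_subspaceW cr => t; rewrite /= in_itv /= => /andP[] //.
have : phi @` (r @` @halfline R) `<=` phi @` (r @` `[0, N]) `|` U.
  move=> _ [_ [t t0 <-] <-]; have [tN|Nt] := leP t N.
    by left; exists (r t) => //; exists t => //=; rewrite in_itv /= tN andbT.
  by right; apply: rM; rewrite (le_lt_trans _ Nt) // le_max lexx.
move=> /closureS /[apply]; rewrite closureU => -[].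
  rewrite -(closure_id _).1; last exact: (compact_closed plane_hausdorff).
  move=> [x _ xw]; have := compactification_open_disc x Cphi.
  by rewrite xw => /open_disc_not_circle.
move=> /(_ V (open_nbhs_nbhs (conj oV wV))) [x Ux].
by have : (U `&` V) x by []; rewrite UV.
Qed.

Lemma ray_bridge_far (phi : plane R -> plane R) r s p q w :
  compactification phi -> {within @halfline R, continuous r} ->
  {within @halfline R, continuous s} -> tends phi r p -> tends phi s q ->
  circle w -> w <> p -> w <> q -> ~ closure (phi @` ray_bridge r s) w.
Proof.
move=> Cphi cr cs rp sq Cw wp wq; rewrite !image_setU !closureU.
move=> [[|]|]; [exact: (ray_far Cphi cr rp)| |exact: (ray_far Cphi cs sq)].
have kK : compact (phi @` seg (r 0) (s 0)).
  apply: continuous_compact; last exact: compact_seg.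
  by apply: continuous_subspaceT; exact: compactification_continuous.
rewrite -(closure_id _).1; last exact: (compact_closed plane_hausdorff).
move=> [x _ xw]; have := compactification_open_disc x Cphi.
by rewrite xw => /open_disc_not_circle.
Qed.

Lemma tends_closure_bridgel (phi : plane R -> plane R) r s p :
  tends phi r p -> closure (phi @` ray_bridge r s) p.
Proof.
move=> rp B /rp [M [_ rM]]; exists (phi (r (Num.max M 0 + 1))); split.
  exists (r (Num.max M 0 + 1)) => //; left; left.
  exists (Num.max M 0 + 1) => //.
  by rewrite /halfline /= addr_ge0 // le_max lexx orbT.
by apply: rM; rewrite (@le_lt_trans _ _ (Num.max M 0)) ?le_max ?lexx // ltrDl.
Qed.

Lemma tends_closure_bridger (phi : plane R -> plane R) r s p :
  tends phi s p -> closure (phi @` ray_bridge r s) p.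
Proof.
move=> rp B /rp [M [_ rM]]; exists (phi (s (Num.max M 0 + 1))); split.
  exists (s (Num.max M 0 + 1)) => //; right.
  exists (Num.max M 0 + 1) => //.
  by rewrite /halfline /= addr_ge0 // le_max lexx orbT.
by apply: rM; rewrite (@le_lt_trans _ _ (Num.max M 0)) ?le_max ?lexx // ltrDl.
Qed.

End DiscTopology.

(** * Boundary limits of transition maps *)

Section Extension.
Variable R : realType.
Implicit Types (p q u v z w : plane R) (a b t : R).

(** Supplies the ends of crosscuts: the arc to reach lies on the circle of [psi], the point to avoid
    on that of [phi]. *)
Definition plenty_of_rays (phi psi : plane R -> plane R) : Prop :=
  forall a b xi, a < b -> circle xi -> exists r p q,
    [/\ {within @halfline R, continuous r}, circle p, p <> xi,
        tends phi r p /\ tends psi r q & open_arc a b q].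

Lemma not_closure_ball (A : set (plane R)) w : ~ closure A w ->
  exists e, 0 < e /\ ball w e `<=` ~` A.
Proof.
move=> nA; apply: contrapT => H; apply: nA => B /nbhs_ballP[e /= e0 eB].
apply: contrapT => AB; apply: H; exists e; split=> // z /eB Bz Az.
by apply: AB; exists z.
Qed.

Lemma open_ball w (e : R) : 0 < e -> open (ball w e).
Proof. by move=> e0; exact: ball_open. Qed.

(* Otherwise the images under [h] of the small half-discs at [xi] accumulate on
   two points [w1], [w2].  Rays ending on both sides of [w1 w2] in [psi], but not
   at [xi] in [phi], are joined into a crosscut; it misses a half-disc at [xi],
   although its [psi]-image has to cross the image of this half-disc. *)
Lemma transition_cluster_uniq (phi psi h h' : plane R -> plane R) xi w1 w2 :
  compactification phi -> compactification psi -> homeo_pair h h' ->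
  (forall x, h' (psi x) = phi x) -> plenty_of_rays phi psi -> circle xi ->
  circle w1 -> circle w2 ->
  (forall e d, 0 < e -> 0 < d ->
    exists z, [/\ open_disc z, ball xi e z & ball w1 d (h z)]) ->
  (forall e d, 0 < e -> 0 < d ->
    exists z, [/\ open_disc z, ball xi e z & ball w2 d (h z)]) ->
  w1 = w2.
Proof.
move=> Cphi Cpsi [hD hc hc' hK hK'] h'psi plenty Cxi Cw1 Cw2 cl1 cl2.
apply: contrapT => w12.
have [a [b [ab ba w1E w2E]]] := circle_cis2 Cw1 Cw2 w12.
(* [r] ends in one arc between [w1] and [w2], and [s] in the other, so the chord between their
   limits separates [w1] from [w2]. *)
have [r [pr [qr [cr Cpr prxi [rpr rqr] [t /= /andP[at_ tb] tE]]]]] := plenty a b xi ab Cxi.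
have [s [ps [qs [cs Cps psxi [sps sqs] [t' /= /andP[bt' t'a] t'E]]]]] := plenty b (a + 2 * pi) xi ba Cxi.
have w1E' : w1 = cis (a + 2 * pi) by rewrite cisD2pi.
have farI : ~ closure (phi @` ray_bridge r s) xi.
  by apply: (ray_bridge_far Cphi cr cs rpr sps) => // E; [apply: prxi|apply: psxi].
have Cqr : circle (cis t) := circle_cis t.
have Cqs : circle (cis t') := circle_cis t'.
rewrite -tE -t'E in rqr sqs.
have sw2 : side (cis t) (cis t') w2 < 0 by rewrite w2E; apply: side_cis_lt0; lra.
have sw1 : 0 < side (cis t) (cis t') w1 by rewrite w1E'; apply: side_cis_gt0; lra.
have qq : cis t <> cis t'.
  by move=> E; move: sw2 sw1; rewrite -E /side; lra.
have side1 x y : side x y x = 0 :> R by rewrite /side; ring.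
have side2 x y : side x y y = 0 :> R by rewrite /side; ring.
have farJ w : circle w -> side (cis t) (cis t') w != 0 ->
    ~ closure (psi @` ray_bridge r s) w.
  move=> Cw sw; apply: (ray_bridge_far Cpsi cr cs rqr sqs) => // E;
    by move: sw; rewrite E ?side1 ?side2 eqxx.
have far1 : ~ closure (psi @` ray_bridge r s) w1 by apply: farJ; rewrite ?gt_eqF.
have far2 : ~ closure (psi @` ray_bridge r s) w2 by apply: farJ; rewrite ?lt_eqF.
have [e [e0 eK]] := not_closure_ball farI.
have [e1 [e10 e1K]] := not_closure_ball far1.
have [e2 [e20 e2K]] := not_closure_ball far2.
have [x1 [Dx1 ex1 hx1]] := cl1 _ _ e0 e10.
have [x2 [Dx2 ex2 hx2]] := cl2 _ _ e0 e20.
have segD := seg_open_disc Dx1 Dx2.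
have sege := seg_ball ex1 ex2.
have chs : {within seg x1 x2, continuous h}.
  by apply: continuous_in_subspaceT => z; rewrite inE => /segD; exact: hc.
(* The two continua to be crossed: [A] joins the limits of the rays, and [B] joins [w1] to [w2]
   through the [h]-image of a segment close to [xi]. *)
pose A := closure (psi @` ray_bridge r s).
pose B := seg w1 (h x1) `|` h @` seg x1 x2 `|` seg (h x2) w2.
have Dw1 := circle_closed_disc Cw1; have Dw2 := circle_closed_disc Cw2.
have AD : A `<=` @closed_disc R.
  rewrite ((closure_id _).1 (@closed_closed_disc R)).
  apply: closureS => _ [x _ <-]; apply: open_closed_disc.
  exact: compactification_open_disc.
have BD : B `<=` @closed_disc R.
  move=> z [[|]|].
  - by apply: seg_closed_disc => //; exact/open_closed_disc/hD.
  - by move=> [y /segD Dy <-]; exact/open_closed_disc/hD.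
  - by apply: seg_closed_disc => //; exact/open_closed_disc/hD.
have kA : compact A.
  by apply: subclosed_compact AD; [exact: closed_closure|exact: compact_closed_disc].
have kB : compact B.
  apply: compactU; [apply: compactU|]; try exact: compact_seg.
  by apply: continuous_compact => //; exact: compact_seg.
have cA : connected A.
  apply: connected_closure; apply: connected_continuous_connected.
    exact: connected_ray_bridge.
  by apply: continuous_subspaceT; exact: compactification_continuous.
have cB : connected B.
  apply: connectedU; [|apply: connectedU|]; try exact: connected_seg.
  - exists (h x2); split; [right|exact: seg_left].
    by exists x2 => //; exact: seg_right.
  - exists (h x1); split; [exact: seg_right|].
    by exists x1 => //; exact: seg_left.
  - by apply: connected_continuous_connected => //; exact: connected_seg.
have Aqr : A (cis t) by exact: tends_closure_bridgel.
have Aqs : A (cis t') by exact: tends_closure_bridger.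
have Bw1 : B w1 by left; left; exact: seg_left.
have Bw2 : B w2 by right; exact: seg_right.
have [z [Az]] := crossing AD BD kA kB cA cB Aqr Aqs Bw2 Bw1 Cqr Cqs Cw2 Cw1 qq sw2 sw1.
have ballA w d : 0 < d -> ball w d `<=` ~` (psi @` ray_bridge r s) -> ~ ball w d z.
  move=> d0 dK dz; have [] := Az (ball w d).
    by apply: open_nbhs_nbhs; split=> //; exact: open_ball.
  by move=> y [yK /dK].
(* The end pieces of [B] lie in balls missing the crosscut. At a point of the middle piece, [h']
   carries a neighbourhood into the ball about [xi], which the crosscut seen in [phi] misses. *)
move=> [[|]|].
- have := seg_ball (ballxx w1 e10) hx1 => /[apply]; exact: ballA.
- move=> [y yseg yz]; have Dy := segD _ yseg.
  have Dz : open_disc z by rewrite -yz; exact: hD.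
  have zn : nbhs z (h' @^-1` ball xi e).
    apply: (hc' _ Dz); rewrite -yz hK //; apply: open_nbhs_nbhs.
    by split; [exact: open_ball|exact: sege].
  have [_ [[x xK <-]]] := Az _ zn.
  by rewrite /= h'psi => /eK; apply; exists x.
- have := seg_ball hx2 (ballxx w2 e20) => /[apply]; exact: ballA.
Qed.

(** Cluster points of [h] at [xi] exist by compactness, lie on the circle, and are unique; in a
    compact set this gives a limit. *)
Lemma transition_limit (phi psi h h' : plane R -> plane R) xi :
  compactification phi -> compactification psi -> homeo_pair h h' ->
  (forall x, h' (psi x) = phi x) -> plenty_of_rays phi psi -> circle xi ->
  exists2 w, circle w & h @ within (@open_disc R) (nbhs xi) --> w.
Proof.
move=> Cphi Cpsi hh h'psi plenty Cxi.
have [hD hc hc' hK hK'] := hh.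
have PF := within_open_disc_proper (circle_closed_disc Cxi).
pose F := h @ within (@open_disc R) (nbhs xi).
have clE w : cluster F w -> forall e d, 0 < e -> 0 < d ->
    exists z, [/\ open_disc z, ball xi e z & ball w d (h z)].
  move=> Fw e d e0 d0; have [] := Fw (h @` (@open_disc R `&` ball xi e)) (ball w d).
  - apply: filterS (nbhsx_ballx xi e e0) => z ez Dz.
    by exists z.
  - exact: nbhsx_ballx.
  - by move=> _ [[z [Dz ez] <-] dz]; exists z.
have FD : F (@closed_disc R).
  by apply: (@filterE _ (nbhs xi)) => z Dz; exact/open_closed_disc/hD.
have clC w : cluster F w -> circle w.
  move=> Fw; have : closed_disc w.
    rewrite ((closure_id _).1 (@closed_closed_disc R)) => B Bw.
    exact: Fw.
  case/closed_disc_cases => // Dw; exfalso.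
  (* If [w] were interior, continuity of [h'] at [w] would place points arbitrarily close to [xi]
     near [h' w], which is away from [xi]. *)
  have [Dw' w'K] := hK' _ Dw.
  have cS : closed ([set h' w] : set (plane R)).
    exact: (@compact_closed (plane R) _ (@plane_hausdorff R) (@compact_set1 (plane R) _)).
  have /not_closure_ball[e [e0 eU]] : ~ closure [set h' w] xi.
    rewrite -((closure_id _).1 cS).
    by move=> E; apply: (open_disc_not_circle Dw'); rewrite -E.
  have e20 : 0 < e / 2 by rewrite divr_gt0.
  have /nbhs_ballP[d /= d0 dP] : nbhs w (h' @^-1` ball (h' w) (e / 2)).
    by apply: (hc' _ Dw); exact: nbhsx_ballx.
  have [z [Dz ez /dP]] := clE _ Fw _ _ e20 d0.
  rewrite /= hK // => /ball_sym hz.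
  by apply: (eU (h' w)) => //; exact: ball_split ez hz.
(* The box is a compact neighbourhood of each point of the circle, which the closed disc is not. *)
pose V : set (plane R) := `[- 2, 2] `*` `[- 2, 2].
have DV : @closed_disc R `<=` V.
  move=> z /closed_disc_box; rewrite !ler_norml /V /= !in_itv /= => -[/andP[? ?] /andP[? ?]].
  by split; apply/andP; split; lra.
have [w [_ Fw]] : @closed_disc R `&` cluster F !=set0.
  exact: compact_closed_disc.
exists w; first exact: clC.
apply: (@compact_cluster_set1 (plane R) w F V (@plane_hausdorff R) (@compact_box R 2)).
- apply/nbhs_ballP; exists 1 => //= z [/= + +]; rewrite /V /ball /= !in_itv /=.
  have [] := closed_disc_box (circle_closed_disc (clC _ Fw)).
  rewrite !ler_norml !ltr_norml => /andP[? ?] /andP[? ?] /andP[? ?] /andP[? ?].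
  by split; apply/andP; split; lra.
- by apply: filterS FD; exact: DV.
- apply/seteqP; split=> [v Fv|v ->//] /=.
  exact: (transition_cluster_uniq Cphi Cpsi hh h'psi plenty Cxi (clC _ Fv)
    (clC _ Fw) (clE _ Fv) (clE _ Fw)).
Qed.

End Extension.

(** * The extension to the closed disc and its behaviour on the circle *)

Section ExtensionProperties.
Variable R : realType.
Implicit Types (p q u v x y z w : plane R) (a b t : R).

Lemma extension_exists (h f : plane R -> plane R) :
  (forall z, open_disc z -> {for z, continuous h}) ->
  (forall z, circle z -> h @ within (@open_disc R) (nbhs z) --> f z) ->
  exists P : plane R -> plane R,
    [/\ {within @closed_disc R, continuous P},
        forall z, open_disc z -> P z = h z &
        forall z, circle z -> P z = f z].
Proof.
move=> hc hf; pose P z := if pselect (open_disc z) then h z else f z.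
have PD z : open_disc z -> P z = h z by rewrite /P; case: pselect.
have PC z : circle z -> P z = f z.
  by move=> Cz; rewrite /P; case: pselect => // Dz; case: (open_disc_not_circle Dz Cz).
have Pcvg z : closed_disc z -> h @ within (@open_disc R) (nbhs z) --> P z.
  move=> /closed_disc_cases[Dz|Cz]; last by rewrite PC //; exact: hf.
  rewrite PD // => B hzB; have hB : nbhs z (h @^-1` B) by exact: (hc _ Dz).
  by apply: (@filterS _ (nbhs z)) hB => y By _.
exists P; split=> //; apply/subspace_continuousP => z Dz B.
move=> /nbhs_ballP[e /= e0 eB].
have e20 : 0 < e / 2 by rewrite divr_gt0.
pose S := [set y | open_disc y -> ball (P z) (e / 2) (h y)].
have Sz : nbhs z S := Pcvg z Dz _ (nbhsx_ballx _ _ e20).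
(* For [y] near [z], [S] is also a neighbourhood of [y], so [P y] is a limit of values of [h] within
   [e / 2] of [P z]. *)
apply: filterS (nbhs_interior Sz) => y Sy Dy; apply: eB.
have PF := within_open_disc_proper Dy.
have : (h @ within (@open_disc R) (nbhs y)) (ball (P z) (e / 2) `&` ball (P y) (e / 2)).
  by apply: filterI; [exact: Sy|exact: (Pcvg y Dy _ (nbhsx_ballx _ _ e20))].
by move=> /filter_ex[v [zv /ball_sym yv]]; exact: ball_split zv yv.
Qed.

Lemma cvg_within_open_disc (f : plane R -> plane R) z :
  {within @closed_disc R, continuous f} -> closed_disc z ->
  f @ within (@open_disc R) (nbhs z) --> f z.
Proof.
move=> /subspace_continuousP cf Dz B Bz.
have fB : nbhs z [set y | closed_disc y -> B (f y)] := cf _ Dz _ Bz.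
by apply: (@filterS _ (nbhs z)) fB => y By Dy; apply: By; exact: open_closed_disc.
Qed.

(** The open disc is dense in the closed one and the plane is Hausdorff. *)
Lemma eq_closed_disc (f g : plane R -> plane R) :
  {within @closed_disc R, continuous f} -> {within @closed_disc R, continuous g} ->
  (forall z, open_disc z -> f z = g z) ->
  forall z, closed_disc z -> f z = g z.
Proof.
move=> cf cg fg z Dz; have PF := within_open_disc_proper Dz.
have fz := cvg_within_open_disc cf Dz; have gz := cvg_within_open_disc cg Dz.
apply: (@plane_hausdorff R) => A B /fz fA /gz gB.
have [y [yA yB Dy]] : exists y, [/\ A (f y), B (g y) & open_disc y].
  have : within (@open_disc R) (nbhs z) (f @^-1` A `&` g @^-1` B `&` @open_disc R).
    apply: filterI; first exact: filterI.
    by apply: (@filterE _ (nbhs z)).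
  by move=> /filter_ex[y [[? ?] ?]]; exists y.
by exists (f y); split=> //; rewrite fg.
Qed.

Lemma connected_zero (T : topologicalType) (A : set T) (f : T -> R) (x y : T) :
  connected A -> {within A, continuous f} -> A x -> A y -> f x < 0 -> 0 < f y ->
  exists2 z, A z & f z = 0.
Proof.
move=> cA cf Ax Ay fx fy.
have /connected_intervalP fA := connected_continuous_connected cA cf.
have [z Az fz] : (f @` A) 0.
  by apply: (fA (f x) (f y)); [exists x|exists y|rewrite !ltW].
by exists z.
Qed.

Lemma continuous_side p q : continuous (side p q).
Proof.
move=> z; apply: cvgB; apply: cvgM; (try exact: cvg_cst);
  apply: cvgB; (try exact: cvg_cst); [exact: cvg_snd|exact: cvg_fst].
Qed.

Lemma continuous_cis : continuous (@cis R).
Proof.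
by move=> t; apply: cvg_plane; [exact: continuous_cos|exact: continuous_sin].
Qed.

Section Boundary.
Variables (h h' P : plane R -> plane R).
Hypotheses (hh : homeo_pair h h') (cP : {within @closed_disc R, continuous P}).
Hypotheses (Ph : forall z, open_disc z -> P z = h z).
Hypotheses (Pcircle : forall z, circle z -> circle (P z)).

Lemma extension_closed_disc z : closed_disc z -> closed_disc (P z).
Proof.
have [hD _ _ _ _] := hh.
move=> /closed_disc_cases[Dz|/Pcircle]; last exact: circle_closed_disc.
by rewrite Ph //; exact/open_closed_disc/hD.
Qed.

(** The image is compact, hence closed, and contains the dense open disc. *)
Lemma extension_image_disc : P @` @closed_disc R = @closed_disc R.
Proof.
have [_ _ _ _ hK'] := hh.
apply/seteqP; split=> [_ [z Dz <-]|]; first exact: extension_closed_disc.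
have kP := continuous_compact cP (@compact_closed_disc R).
rewrite ((closure_id (P @` _)).1 (compact_closed (@plane_hausdorff R) kP)).
move=> z /closure_open_disc; apply: closureS => w Dw.
have [Dw' w'K] := hK' _ Dw.
by exists (h' w); [exact: open_closed_disc|rewrite Ph].
Qed.

Lemma extension_image_circle : P @` @circle R = @circle R.
Proof.
have [hD _ _ _ _] := hh.
apply/seteqP; split=> [_ [z Cz <-]|w Cw]; first exact: Pcircle.
have : (P @` @closed_disc R) w.
  by rewrite extension_image_disc; exact: circle_closed_disc.
move=> [z /closed_disc_cases[Dz|Cz] zw]; last by exists z.
have := hD _ Dz; rewrite -Ph // zw => /open_disc_not_circle.
by move/(_ Cw).
Qed.

(* If [P x = P y] differs from [P u] and [P v], then the [P]-image of the chord
   [uv] misses a ball at [P x], in which points close to [P x] and to [P y] can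
   be joined by a segment; its preimage joins the two sides of the chord
   without meeting it. *)
Lemma extension_monotone x y u v :
  circle x -> circle y -> circle u -> circle v -> P x = P y ->
  side u v x < 0 -> 0 < side u v y -> P u = P x \/ P v = P x.
Proof.
move=> Cx Cy Cu Cv Pxy sx sy; have [hD hc hc' hK hK'] := hh.
apply: contrapT => /not_orP[Pux Pvx].
have uv : u <> v by move=> E; move: sx sy; rewrite E /side; lra.
have segD : seg u v `<=` @closed_disc R.
  by apply: seg_closed_disc; exact: circle_closed_disc.
have kS : compact (P @` seg u v).
  apply: continuous_compact; last exact: compact_seg.
  exact: continuous_subspaceW cP.
have nS : ~ (P @` seg u v) (P x).
  move=> [z [t]]; rewrite /= in_itv /= => /andP[t0 t1] <- Pz.
  have [t0E|t0'] := eqVneq t 0; first by apply: Pux; rewrite -Pz t0E segpt0.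
  have [t1E|t1'] := eqVneq t 1; first by apply: Pvx; rewrite -Pz t1E segpt1.
  have Dz : open_disc (segpt u v t).
    by apply: chord_open_disc => //; rewrite !lt_neqAle t0 t1 t1' eq_sym t0'.
  by have := hD _ Dz; rewrite -Ph // Pz => /open_disc_not_circle; apply; exact: Pcircle.
have [e [e0 eS]] : exists e, 0 < e /\ ball (P x) e `<=` ~` (P @` seg u v).
  apply: not_closure_ball.
  by rewrite -((closure_id _).1 (compact_closed (@plane_hausdorff R) kS)).
(* Replaces a boundary point by an interior one on the same side of the chord, so that [h'] can be
   applied to the segment between the images. *)
have near0 w (S : set R) : circle w -> P w = P x -> open S -> S (side u v w) ->
    exists z, [/\ open_disc z, S (side u v z) & ball (P x) e (h z)].
  move=> Cw Pw oS Sw; have Dw := circle_closed_disc Cw.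
  have H1 : nbhs w (side u v @^-1` S).
    by apply: continuous_side; exact: open_nbhs_nbhs.
  have H2 : nbhs w [set z | open_disc z -> ball (P x) e (P z)].
    by have := cvg_within_open_disc cP Dw (nbhsx_ballx _ _ e0); rewrite Pw.
  have [z [Dz [/= Sz ez]]] := closure_open_disc Dw (filterI H1 H2).
  by exists z; split=> //; rewrite -Ph //; exact: ez.
have [x' [Dx' sx' ex']] := near0 x [set t | t < 0] Cx erefl (@open_lt _ _) sx.
have [y' [Dy' sy' ey']] := near0 y [set t | t > 0] Cy (esym Pxy) (@open_gt _ _) sy.
have sD := seg_open_disc (hD _ Dx') (hD _ Dy').
have se := seg_ball ex' ey'.
have cT : connected (h' @` seg (h x') (h y')).
  apply: connected_continuous_connected; first exact: connected_seg.
  by apply: continuous_in_subspaceT => z; rewrite inE => /sD; exact: hc'.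
have [_ [z zs <-] sz] : exists2 z, (h' @` seg (h x') (h y')) z & side u v z = 0.
  apply: (@connected_zero _ _ _ x' y') => //.
  - by apply: continuous_subspaceT; exact: continuous_side.
  - by exists (h x'); [exact: seg_left|rewrite hK].
  - by exists (h y'); [exact: seg_right|rewrite hK].
have [Dz zK] := hK' _ (sD _ zs).
apply: (eS z (se _ zs)); exists (h' z); last by rewrite Ph.
exact: side_eq0_seg (open_closed_disc Dz) sz.
Qed.

(** The same dichotomy in angles: the chord from [cis u] to [cis v] separates [cis b] from [cis a],
    the latter read at [a + 2 * pi], beyond [v]. *)
Lemma extension_monotone_arc (a u b v : R) : a < u -> u < b -> b < v -> v < a + 2 * pi ->
  P (cis a) = P (cis b) -> P (cis u) = P (cis a) \/ P (cis v) = P (cis a).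
Proof.
move=> au ub bv va Pab; rewrite Pab.
apply: (@extension_monotone (cis b) (cis a)); rewrite ?Pab //; try exact: circle_cis.
  by apply: side_cis_lt0; lra.
by rewrite -(cisD2pi a); apply: side_cis_gt0; lra.
Qed.

Lemma extension_tends (phi psi : plane R -> plane R) (s : R -> plane R) p q :
  (forall x, open_disc (phi x)) -> (forall x, P (phi x) = psi x) ->
  closed_disc p -> tends phi s p -> tends psi s q -> P p = q.
Proof.
move=> phiD Pphi Dp sp sq.
apply: (cvg_unique (@plane_hausdorff R) _ sq).
rewrite (_ : (fun t => psi (s t)) = (fun t => P (phi (s t)))); last first.
  by apply/funext => t; rewrite Pphi.
move=> B Bp; have : \forall t \near +oo, (open_disc (phi (s t)) -> B (P (phi (s t)))).
  exact: (sp _ (cvg_within_open_disc cP Dp Bp)).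
by apply: filterS => t; apply.
Qed.

End Boundary.

End ExtensionProperties.

(** * Fibers of the extension on the circle *)

Section Collapse.
Variables (R : realType) (k : nat) (Rf : 'I_k -> set (R -> plane R)).
Hypothesis Rf_ray : forall i r, Rf i r -> is_ray r.
Variables (I J : {set 'I_k}) (phiI phiJ : plane R -> plane R).
Hypotheses (JI : J \subset I).
Hypotheses (CI : compactification_for Rf I phiI).
Hypotheses (CJ : compactification_for Rf J phiJ).
Implicit Types (p q x y : plane R) (a b t : R).

Lemma plenty_of_family_rays : plenty_of_rays phiI phiJ.
Proof.
have [CpI limI injI _] := CI; have [_ _ _ denseJ] := CJ.
move=> a b xi ab Cxi.
have [i [r [s [p [q [iJ [Rr Rs] rs [rp sq] [ap aq]]]]]]] := denseJ a b ab.
have iI := fintype.subsetP JI _ iJ.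
have [p' [Cp' rp']] := limI _ _ iI Rr.
have [q' [Cq' sq']] := limI _ _ iI Rs.
have pq := injI _ _ _ _ _ iI Rr Rs rs Cp' Cq' rp' sq'.
have [pxi|pxi] := pselect (p' = xi).
  exists s, q', q; split=> //; first by have [[]] := Rf_ray Rs.
  by move=> E; apply: pq; rewrite E.
by exists r, p', p; split=> //; have [[]] := Rf_ray Rr.
Qed.

Variables (h h' P : plane R -> plane R).
Hypotheses (hh : homeo_pair h h') (cP : {within @closed_disc R, continuous P}).
Hypotheses (Ph : forall z, open_disc z -> P z = h z).
Hypotheses (Pcircle : forall z, circle z -> circle (P z)).
Hypothesis PI : forall x, P (phiI x) = phiJ x.

(** Transfers the density of ends of rays from the circle of [phiJ] to limit points on the circle of
    [phiI], through [P]. *)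
Lemma limit_point_dense a b : a < b -> exists p q,
  [/\ limit_points Rf J phiI p, circle p, P p = q & open_arc a b q].
Proof.
have [CpI limI _ _] := CI; have [_ _ _ denseJ] := CJ.
move=> ab; have [i [r [_ [q [_ [iJ [Rr _] _ [rq _] [aq _]]]]]]] := denseJ a b ab.
have [p [Cp rp]] := limI _ _ (fintype.subsetP JI _ iJ) Rr.
exists p, q; split=> //; first by split=> //; exists i, r.
apply: (extension_tends cP _ PI (circle_closed_disc Cp) rp rq) => x.
exact: compactification_open_disc.
Qed.

(** If [P] separated the endpoints, two limit points [p1], [p2] would have images on both sides of
    them, and the image of the interval would have to pass through one of these images. *)
Lemma free_interval_eq p q : free_interval Rf J phiI p q -> P p = P q.
Proof.
move=> [a [b [ab -> -> free]]]; apply: contrapT => Pab.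
have [al [be [albe beal Pa Pb]]] :=
  circle_cis2 (Pcircle (circle_cis a)) (Pcircle (circle_cis b)) Pab.
have [p1 [_ [Lp1 Cp1 <- [t1 /= /andP[alt1 t1be] Pp1]]]] := limit_point_dense albe.
have [p2 [_ [Lp2 Cp2 <- [t2 /= /andP[bet2 t2al] Pp2]]]] := limit_point_dense beal.
have sa : 0 < side (P p1) (P p2) (P (cis a)).
  by rewrite Pa -Pp1 -Pp2 -(cisD2pi al); apply: side_cis_gt0; lra.
have sb : side (P p1) (P p2) (P (cis b)) < 0.
  by rewrite Pb -Pp1 -Pp2; apply: side_cis_lt0; lra.
have p12 : P p1 <> P p2 by move=> E; move: sa sb; rewrite E /side; lra.
have Pcis : continuous (fun t => P (cis t)).
  move=> t B Bt.
  have Dcis s : closed_disc (cis s : plane R).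
    by apply: circle_closed_disc; exact: circle_cis.
  have B1 : nbhs (cis t : plane R) [set y | closed_disc y -> B (P y)].
    by move: cP => /subspace_continuousP/(_ _ (Dcis t)); apply.
  have B2 : nbhs t [set s | closed_disc (cis s : plane R) -> B (P (cis s))].
    exact: (@continuous_cis R t _ B1).
  by apply: (@filterS _ (nbhs t)) B2 => s; apply.
(* The path [P (cis t)] stays on the circle, so it meets the chord from [P p1] to [P p2] only at its
   endpoints. *)
have [t] : exists2 t, `[a, b]%classic t & side (P p1) (P p2) (P (cis t)) = 0.
  apply: (@connected_zero _ _ _ _ b a) => //.
  - exact: segment_connected.
  - apply: continuous_subspaceT => t.
    by apply: continuous_comp; [exact: Pcis|exact: continuous_side].
  - by rewrite /= in_itv /= lexx ab.
  - by rewrite /= in_itv /= lexx ab.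
rewrite /= in_itv /= => /andP[at_ tb] st.
have ta : a < t.
  by rewrite lt_neqAle at_ andbT; apply/eqP => E; move: sa; rewrite E st ltxx.
have {at_}tb' : t < b.
  by rewrite lt_neqAle tb andbT; apply/eqP => E; move: sb; rewrite -E st ltxx.
have Pcirc s : circle (P (cis s)) by apply: Pcircle; exact: circle_cis.
have [p0 [Lp0 Cp0 Pp0]] : exists p, [/\ limit_points Rf J phiI p, circle p & P p = P (cis t)].
  by have [E|E] := side_eq0_circle (Pcircle Cp1) (Pcircle Cp2) p12 (Pcirc t) st;
    [exists p1|exists p2].
have Pta : P (cis a) <> P (cis t).
  by move=> E; move: sa; rewrite E st ltxx.
have Ptb : P (cis b) <> P (cis t).
  by move=> E; move: sb; rewrite E st ltxx.
(* The limit point [cis s] with the same image as [cis t] lies outside the free interval, so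
   [t < b < s < a + 2 * pi]. Monotonicity then gives an endpoint the value [P (cis t)]. *)
have [s [/andP[as_ sa2] sE]] := circle_cis_ge a Cp0.
rewrite sE in Pp0 Lp0.
have as' : a < s.
  by rewrite lt_neqAle as_ andbT; apply/eqP => E; apply: Pta; rewrite E.
have [sb'|] := ltP s b.
  by have : set0 (cis s) by [rewrite -free; split=> //; exists s => //=; rewrite as' sb'].
rewrite le_eqVlt => /predU1P[E|bs]; first by apply: Ptb; rewrite E.
have t2pi : a + 2 * pi < t + 2 * pi by rewrite ltrD2r.
have [//|] := extension_monotone_arc hh cP Ph Pcircle tb' bs sa2 t2pi (esym Pp0).
by rewrite cisD2pi.
Qed.

Let rays_in a b (j : 'I_k) : Prop := exists r t,
  [/\ j \in J, Rf j r, a < t, t < b & tends phiI r (cis t)].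

(* A family [Rf j] has at most one limit point in an arc collapsed by [P], and
   cutting the arc there removes [j] from the families with limit points. *)
Lemma constant_arc_collapsed n a b : a <= b -> b < a + 2 * pi ->
  (forall t, a <= t <= b -> P (cis t) = P (cis a)) ->
  (#|[set j | `[< rays_in a b j >]]%SET| <= n)%N ->
  collapsed Rf J phiI (cis a) (cis b).
Proof.
have [CpI limI injI _] := CI; have [_ limJ injJ _] := CJ.
elim: n a b => [|n IH] a b ab ba cst card.
  apply: Relation_Operators.rst_step; exists a, b; split=> //.
  apply/seteqP; split=> // _ [[t /= /andP[ta tb] <-] [_ [j [r [jJ Rr rt]]]]].
  move: card; rewrite leqn0 cards_eq0 => /eqP/setP/(_ j).
  rewrite !inE => /asboolP; apply.
  by exists r, t.
have [[j [r [t [jJ Rr ta tb rt]]]]|none] := pselect (exists j, rays_in a b j).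
  (* Two rays of the family ending in the arc would have the same limit for [phiJ]; one ray has a
     single limit, and [cis] is injective on the arc. *)
  have uniq s : a < s -> s < b -> s <> t -> ~ exists2 r', Rf j r' & tends phiI r' (cis s).
    move=> as_ sb st [r' Rr' r's].
    have [E|rr'] := pselect (r = r').
      rewrite E in rt.
      have E' : cis s = cis t :> plane R.
        exact: (cvg_unique (@plane_hausdorff R) r's rt).
      have [lst|lts|//] := ltgtP s t.
        by apply: st; apply: cis_inj E'; [exact: ltW|lra].
      by apply: st; apply/esym; apply: cis_inj (esym E'); [exact: ltW|lra].
    have [q [Cq rq]] := limJ _ _ jJ Rr; have [q' [Cq' rq']] := limJ _ _ jJ Rr'.
    have phiD x : open_disc (phiI x) by exact: compactification_open_disc.
    have Dcis u : closed_disc (cis u : plane R).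
      by apply: circle_closed_disc; exact: circle_cis.
    have Pt := extension_tends cP phiD PI (Dcis t) rt rq.
    have Ps := extension_tends cP phiD PI (Dcis s) r's rq'.
    apply: (injJ _ _ _ _ _ jJ Rr Rr' rr' Cq Cq' rq rq').
    by rewrite -Pt -Ps !cst //; apply/andP; split; exact: ltW.
  have sub a' b' : a <= a' -> b' <= b -> ~ (a' < t /\ t < b') ->
      (#|[set j | `[< rays_in a' b' j >]]%SET| <= n)%N.
    move=> aa bb nt; rewrite -ltnS; apply: leq_trans card.
    apply: proper_card; apply/properP; split.
      apply/fintype.subsetP => i; rewrite !inE.
      move=> [r' [s [iJ Rr' as_ sb r's]]].
      exists r', s; split=> //; first exact: le_lt_trans as_.
      exact: lt_le_trans bb.
    exists j; first by rewrite !inE; exists r, t.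
    apply/negP; rewrite !inE => -[r' [s [_ Rr' as_ sb r's]]].
    apply: (uniq s); [exact: le_lt_trans as_|exact: lt_le_trans bb| |by exists r'].
    by move=> E; apply: nt; rewrite -E.
  apply: (@Relation_Operators.rst_trans _ _ _ (cis t)); apply: IH.
  - exact: ltW.
  - by lra.
  - by move=> s /andP[as_ st]; apply: cst; rewrite as_ (le_trans st) // ltW.
  - by apply: sub; rewrite ?ltxx //; [exact: ltW|case].
  - exact: ltW.
  - by lra.
  - move=> s /andP[ts sb]; rewrite !cst //; first by rewrite !ltW.
    by rewrite sb andbT (le_trans _ ts) // ltW.
  - by apply: sub; rewrite ?ltxx //; [exact: ltW|case].
apply: Relation_Operators.rst_step; exists a, b; split=> //.
apply/seteqP; split=> // _ [[t /= /andP[ta tb] <-] [_ [j [r [jJ Rr rt]]]]].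
by apply: none; exists j, r, t.
Qed.

(** By monotonicity [P] is constant on one of the two arcs between [p] and [q]. *)
Lemma eq_collapsed p q : circle p -> circle q -> P p = P q ->
  collapsed Rf J phiI p q.
Proof.
move=> Cp Cq Ppq; have [->|pq] := pselect (p = q).
  exact: Relation_Operators.rst_refl.
have [a [b [ab ba pE qE]]] := circle_cis2 Cp Cq pq.
rewrite {}pE {}qE {Cp Cq pq} in Ppq *.
have [cst|/existsNP[u /not_implyP[/andP[au ub] Pu]]] :=
  pselect (forall t, a < t < b -> P (cis t) = P (cis a)).
  apply: (@constant_arc_collapsed _ a b) (leqnn _) => //; first exact: ltW.
  move=> t /andP[]; rewrite le_eqVlt => /predU1P[->//|ta].
  rewrite le_eqVlt => /predU1P[->//|tb].
  by apply: cst; rewrite ta.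
(* Since [cis u] has another value, monotonicity forces the value [P (cis a)] on the complementary
   arc, run from [b] to [a + 2 * pi]. *)
apply: Relation_Operators.rst_sym; rewrite -(cisD2pi a).
apply: (@constant_arc_collapsed _ b (a + 2 * pi)) (leqnn _); [exact: ltW|lra|].
move=> t /andP[]; rewrite le_eqVlt => /predU1P[->//|tb].
rewrite le_eqVlt => /predU1P[->|ta]; first by rewrite cisD2pi.
have [//|] := extension_monotone_arc hh cP Ph Pcircle au ub tb ta Ppq.
by rewrite Ppq.
Qed.

Lemma fiber_collapsed p q : circle p -> circle q ->
  (P p = P q <-> collapsed Rf J phiI p q).
Proof.
move=> Cp Cq; split; first exact: eq_collapsed.
by elim=> [x y /free_interval_eq|x|x y _ ->|x y z _ -> _ ->].
Qed.

End Collapse.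

(** * Uniqueness of the extension and compatibility with composition *)

Lemma extends_identity_eq (R : realType) (phi psi P P' : plane R -> plane R) :
  compactification phi -> extends_identity phi psi P ->
  {within @closed_disc R, continuous P'} -> (forall x, P' (phi x) = psi x) ->
  forall p, closed_disc p -> P' p = P p.
Proof.
move=> [_ phiD] [cP _ Pphi] cP' P'phi; apply: eq_closed_disc => // z.
by rewrite -phiD => -[x _ <-]; rewrite Pphi P'phi.
Qed.

Theorem proposition2p4 (R : realType) (k : nat)
    (Rf : 'I_k -> set (R -> plane R))
    (Rf_ray : forall i r, Rf i r -> is_ray r)
    (Rf_disjoint : forall i j r, Rf i r -> Rf j r -> i = j)
    (Rf_germs : forall i j r s, Rf i r -> Rf j s -> r <> s -> disjoint_germs r s)
    (Rf_separating : forall i, exists E : set (R -> plane R),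
       countable E /\ separating E (Rf i)) :
  (forall (I J : {set 'I_k}) (phiI phiJ : plane R -> plane R),
     J \subset I ->
     compactification_for Rf I phiI -> compactification_for Rf J phiJ ->
     exists P : plane R -> plane R,
       [/\ extends_identity phiI phiJ P,
           forall P', extends_identity phiI phiJ P' ->
             forall p, closed_disc p -> P' p = P p,
           P @` @closed_disc R = @closed_disc R,
           P @` @circle R = @circle R &
           forall p q, circle p -> circle q ->
             (P p = P q <-> collapsed Rf J phiI p q)]) /\
  (forall (I J K : {set 'I_k}) (phiI phiJ phiK PIJ PJK PIK : plane R -> plane R),
     J \subset I -> K \subset J ->
     compactification_for Rf I phiI -> compactification_for Rf J phiJ ->
     compactification_for Rf K phiK ->
     extends_identity phiI phiJ PIJ -> extends_identity phiJ phiK PJK ->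
     extends_identity phiI phiK PIK ->
     forall p, closed_disc p -> PIK p = PJK (PIJ p)).
Proof.
split=> [I J phiI phiJ JI CI CJ|I J K phiI phiJ phiK PIJ PJK PIK _ _ CI _ _].
  have [CpI _ _ _] := CI; have [CpJ _ _ _] := CJ.
  have [h [h' [hh hphi h'phi]]] := transition CpI CpJ.
  have plenty := plenty_of_family_rays Rf_ray JI CI CJ.
  have /choice[f fP] : forall z, exists w, circle z ->
      circle w /\ h @ within (@open_disc R) (nbhs z) --> w.
    (* Off the circle, [z] itself serves as a default value. *)
    move=> z; have [Cz|nCz] := pselect (circle z); last by exists z.
    by have [w] := transition_limit CpI CpJ hh h'phi plenty Cz; exists w.
  have [_ hc _ _ _] := hh.
  have [P [cP Ph Pf]] := extension_exists hc (fun z Cz => (fP z Cz).2).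
  have Pcircle z : circle z -> circle (P z).
    by move=> Cz; rewrite Pf //; have [] := fP z Cz.
  have PphiI x : P (phiI x) = phiJ x.
    by rewrite Ph ?hphi //; exact: compactification_open_disc.
  have PE : extends_identity phiI phiJ P.
    by split=> // z; exact: (extension_closed_disc hh Ph Pcircle).
  exists P; split=> //.
  - by move=> P' [cP' _ P'phi]; exact: extends_identity_eq PE cP' P'phi.
  - exact: extension_image_disc hh cP Ph Pcircle.
  - exact: extension_image_circle hh cP Ph Pcircle.
  - by move=> p q Cp Cq; exact: (fiber_collapsed JI CI CJ hh cP Ph Pcircle PphiI Cp Cq).
have [CpI _ _ _] := CI.
move=> [cIJ DIJ EIJ] [cJK DJK EJK] EIK p Dp; apply/esym.
(* The composite also extends the identity, so uniqueness applies; its continuity within the disc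
   relies on [PIJ] preserving the disc. *)
apply: (@extends_identity_eq _ phiI phiK PIK (PJK \o PIJ)) => //.
  apply/subspace_continuousP => z Dz B Bz.
  move: cIJ cJK => /subspace_continuousP cIJ /subspace_continuousP cJK.
  have B1 : nbhs (PIJ z) [set y | closed_disc y -> B (PJK y)].
    exact: (cJK _ (DIJ _ Dz) _ Bz).
  have B2 : nbhs z [set y | closed_disc y -> closed_disc (PIJ y) -> B (PJK (PIJ y))].
    exact: (cIJ _ Dz _ B1).
  by apply: (@filterS _ (nbhs z)) B2 => y yB Dy; apply: yB => //; exact: DIJ.
by move=> x /=; rewrite EIJ EJK.
Qed.
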